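(* Let $f:\mathbb{D}\to\mathbb{D}$ be analytic with $\mathbb{A}_H(f(\mathbb{D}))<\infty$. For any $\theta\in\mathbb{R}$ and $\rho_0>0$, let $L_H(\rho_0)=\int_0^{\rho_0}\|f'(\gamma(t))\|_{H\to H}\,dt$, where $\gamma(t)=\tanh(\frac{t}{2})e^{i\theta}$; this is the hyperbolic length of the image under $f$ of the radial segment $[0,\tanh(\frac{\rho_0}{2})e^{i\theta}]$, which has hyperbolic length $\rho_0$. Then $$L_H(\rho_0)=o(\rho_0^{1/2})\quad\text{as }\rho_0\to\infty.$$
   Context: $\mathbb{D}=\{|z|<1\}$ carries the hyperbolic metric with density $\lambda_H(z)=2/(1-|z|^2)$. $\|f'(z)\|_{H\to H}=|f'(z)|\lambda_H(f(z))/\lambda_H(z)$. $\mathbb{A}_H(f(\mathbb{D}))=\int_{\mathbb{D}}|f'(z)|^2\lambda_H(f(z))^2\,dx\,dy$ is the hyperbolic area of the image counting multiplicity. *)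

(* Defs.v *)
From Stdlib Require Import Reals.
Open Scope R_scope.

Definition Cx : Type := (R * R)%type.
Definition Cadd (z w : Cx) : Cx := (fst z + fst w, snd z + snd w).
Definition Csub (z w : Cx) : Cx := (fst z - fst w, snd z - snd w).
Definition Cmul (z w : Cx) : Cx :=
  (fst z * fst w - snd z * snd w, fst z * snd w + snd z * fst w).
Definition Cmod (z : Cx) : R := sqrt (fst z ^ 2 + snd z ^ 2).

Definition has_cderiv (f : Cx -> Cx) (z L : Cx) : Prop :=
  forall eps : R, 0 < eps -> exists delta : R, 0 < delta /\
    forall h : Cx, 0 < Cmod h < delta ->
      Cmod (Csub (Csub (f (Cadd z h)) (f z)) (Cmul L h)) <= eps * Cmod h.

Definition lamH (z : Cx) : R := 2 / (1 - Cmod z ^ 2).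

Definition hyp_norm_deriv (f fp : Cx -> Cx) (z : Cx) : R :=
  Cmod (fp z) * lamH (f z) / lamH z.

Definition is_RInt (g : R -> R) (a b v : R) : Prop :=
  exists pr : Riemann_integrable g a b, RiemannInt pr = v.

Definition area_density (f fp : Cx -> Cx) (x y : R) : R :=
  Cmod (fp (x, y)) ^ 2 * lamH (f (x, y)) ^ 2.

(* A_H(f(D)) < infinity: the (nonnegative) integrand integrated over the
   discs {|z| <= r}, r < 1 (as iterated Cartesian Riemann integrals),
   is uniformly bounded; the improper integral over D is the sup of these. *)
Definition hyp_area_finite (f fp : Cx -> Cx) : Prop :=
  exists M : R, forall r : R, 0 < r < 1 ->
    forall (g : R -> R) (A : R),
      (forall x, -r <= x <= r ->
         is_RInt (area_density f fp x) (- sqrt (r ^ 2 - x ^ 2))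
                 (sqrt (r ^ 2 - x ^ 2)) (g x)) ->
      is_RInt g (- r) r A -> A <= M.

Definition gamma (theta t : R) : Cx :=
  (tanh (t / 2) * cos theta, tanh (t / 2) * sin theta).

Definition LH_integrand (f fp : Cx -> Cx) (theta : R) (t : R) : R :=
  hyp_norm_deriv f fp (gamma theta t).

(* Main.v *)
(** The density P = |f'| lambda_H(f) satisfies a sub-mean-value inequality: if f is post-composed
with the disc automorphism g sending f(z0) to 0, then |(g o f)'| <= P/2 with equality at z0, and
Cauchy's formula for (g o f)' on the boundaries of the concentric squares around z0, integrated
over their half-sizes t < s, gives pi s^2 P(z0) <= 2 int_Q P, hence s^2 P(z0)^2 <= 2 int_Q P^2.
With s comparable to 1 - |z0|^2 the square around gamma(t) lies in the hyperbolic annulus of radii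
t - 1 and t + 1, so |f'|_{H->H}^2 at gamma(t) is bounded by a constant times the area of the image
of that annulus. These areas telescope along the ray; finiteness of the total area makes the tail
small, and the inequality 2 h <= eta + h^2 / eta with eta ~ eps / sqrt rho0 concludes.

Since f is only assumed complex differentiable at each point, the continuity of f' and Cauchy's
formula are derived from Goursat's theorem on rectangles. *)

From Stdlib Require Import Reals Lra Lia Classical IndefiniteDescription.
Require Import Defs.
From Coquelicot Require Import Coquelicot.
Open Scope R_scope.

(** Squares replace discs because [hyp_area_finite] is phrased with iterated Cartesian integrals:
    the sub-mean-value inequality then needs Fubini on rectangles only, with no passage to polar
    coordinates. The price is a factor sqrt 2 for corners, rounded up to 3/2 throughout. No
    Laplacian of P is computed: the automorphism turns subharmonicity at one point into the triangle
    inequality in Cauchy's formula. Integrability is the other obstacle, since P is meaningful in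
    the open disc only. For each radius below 1 it is precomposed with a retraction onto the closed
    disc, so that the integrands become continuous on the whole plane and every integral exists. The
    quadratic inequality with a free parameter eta plays the part of Cauchy-Schwarz: it is linear in
    the annular areas, so unit steps along the ray can be summed and telescoped before eta is fixed.
    The initial stretch of the ray contributes a constant, which a large sqrt rho0 absorbs; this is
    why the bound is o and not merely O. *)

Notation CV := C_R_CompleteNormedModule.

(** * Calculus of complex differentiability and continuity *)

Definition cdiff (f : C -> C) (z L : C) : Prop :=
  forall eps, 0 < eps -> exists delta, 0 < delta /\
    forall w : C, Cmod (w - z) < delta ->
      Cmod (f w - f z - L * (w - z)) <= eps * Cmod (w - z).

Definition ccont (f : C -> C) (z : C) : Prop :=
  forall eps, 0 < eps -> exists delta, 0 < delta /\
    forall w : C, Cmod (w - z) < delta -> Cmod (f w - f z) < eps.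

(** The increment may vanish in [cdiff], which spares a case distinction in the chain rule; for a
    zero increment both sides are 0. [Cx] and Coquelicot's [C] are convertible, as are the two
    moduli. *)
Lemma has_cderiv_cdiff f z L : has_cderiv f z L -> cdiff f z L.
Proof.
intros H eps He. destruct (H eps He) as [d [Hd H']]. exists d. split; [exact Hd|].
intros w Hw.
destruct (Req_dec (Cmod (w - z)) 0) as [E|E].
- apply Cmod_eq_0 in E. assert (w = z) by (rewrite <- (Cplus_0_l z), <- E; ring).
  subst w. replace (f z - f z - L * (z - z))%C with (RtoC 0) by ring.
  rewrite Cmod_0. apply Rmult_le_pos; [lra|apply Cmod_ge_0].
- assert (Hc : 0 < Defs.Cmod (w - z)%C < d).
  { split; [|exact Hw]. pose proof (Cmod_ge_0 (w - z)). change (0 < Cmod (w - z)). lra. }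
  specialize (H' _ Hc).
  replace (Cadd z (w - z)%C) with w in H'. exact H'.
  change (w = (z + (w - z))%C). ring.
Qed.

Lemma Cmod_sub_le (z w : C) : Cmod z <= Cmod w + Cmod (z - w).
Proof. replace z with (w + (z - w))%C at 1 by ring. apply Cmod_triangle. Qed.

Lemma Cmod_swap (z w : C) : Cmod (z - w) = Cmod (w - z).
Proof. rewrite <- Cmod_opp. f_equal. ring. Qed.

Lemma cdiff_lip f z L : cdiff f z L -> exists delta, 0 < delta /\
  forall w : C, Cmod (w - z) < delta ->
    Cmod (f w - f z) <= (Cmod L + 1) * Cmod (w - z).
Proof.
intros H. destruct (H 1 Rlt_0_1) as [d [Hd H']]. exists d. split; [exact Hd|].
intros w Hw. specialize (H' w Hw).
pose proof (Cmod_sub_le (f w - f z) (L * (w - z))) as T.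
rewrite Cmod_mult in T. lra.
Qed.

Lemma cdiff_ccont f z L : cdiff f z L -> ccont f z.
Proof.
intros H eps He. destruct (cdiff_lip _ _ _ H) as [d [Hd H']].
pose proof (Cmod_ge_0 L).
exists (Rmin d (eps / (Cmod L + 1))). split.
- apply Rmin_pos; [exact Hd|]. apply Rdiv_lt_0_compat; lra.
- intros w Hw. assert (Cmod (w - z) < d) by (eapply Rlt_le_trans; [exact Hw|apply Rmin_l]).
  assert (Cmod (w - z) < eps / (Cmod L + 1)) by (eapply Rlt_le_trans; [exact Hw|apply Rmin_r]).
  eapply Rle_lt_trans; [apply H'; assumption|].
  replace eps with ((Cmod L + 1) * (eps / (Cmod L + 1))) by (field; lra).
  apply Rmult_lt_compat_l; lra.
Qed.

Lemma cdiff_const (k z : C) : cdiff (fun _ => k) z 0.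
Proof.
intros eps He. exists 1. split; [lra|]. intros w _.
replace (k - k - 0 * (w - z))%C with (RtoC 0) by ring. rewrite Cmod_0.
apply Rmult_le_pos; [lra|apply Cmod_ge_0].
Qed.

Lemma cdiff_id z : cdiff (fun w => w) z 1.
Proof.
intros eps He. exists 1. split; [lra|]. intros w _.
replace (w - z - 1 * (w - z))%C with (RtoC 0) by ring. rewrite Cmod_0.
apply Rmult_le_pos; [lra|apply Cmod_ge_0].
Qed.

Lemma cdiff_plus f g z L M : cdiff f z L -> cdiff g z M ->
  cdiff (fun w => f w + g w)%C z (L + M)%C.
Proof.
intros Hf Hg eps He.
destruct (Hf (eps / 2)) as [d1 [Hd1 H1]]; [lra|].
destruct (Hg (eps / 2)) as [d2 [Hd2 H2]]; [lra|].
exists (Rmin d1 d2). split; [apply Rmin_pos; assumption|]. intros w Hw.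
assert (Cmod (w - z) < d1) by (eapply Rlt_le_trans; [exact Hw|apply Rmin_l]).
assert (Cmod (w - z) < d2) by (eapply Rlt_le_trans; [exact Hw|apply Rmin_r]).
replace (f w + g w - (f z + g z) - (L + M) * (w - z))%C
  with ((f w - f z - L * (w - z)) + (g w - g z - M * (w - z)))%C by ring.
eapply Rle_trans; [apply Cmod_triangle|].
specialize (H1 w H). specialize (H2 w H0). lra.
Qed.

Lemma cdiff_mult f g z L M : cdiff f z L -> cdiff g z M ->
  cdiff (fun w => f w * g w)%C z (L * g z + f z * M)%C.
Proof.
intros Hf Hg eps He.
pose proof (Cmod_ge_0 (f z)) as P1. pose proof (Cmod_ge_0 (g z)) as P2.
pose proof (Cmod_ge_0 L) as P3.
set (K := Cmod (f z) + Cmod (g z) + Cmod L + 1).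
assert (HK : 0 < K) by (unfold K; lra).
set (e := eps / (3 * K)).
assert (He' : 0 < e) by (apply Rdiv_lt_0_compat; lra).
assert (HeK : e * K = eps / 3) by (unfold e; field; lra).
destruct (Hf e He') as [d1 [Hd1 H1]].
destruct (Hg e He') as [d2 [Hd2 H2]].
destruct (cdiff_ccont _ _ _ Hg (Rmin 1 e)) as [d3 [Hd3 H3]]; [apply Rmin_pos; lra|].
exists (Rmin d1 (Rmin d2 d3)). split; [repeat apply Rmin_pos; assumption|]. intros w Hw.
assert (W1 : Cmod (w - z) < d1) by (eapply Rlt_le_trans; [exact Hw|apply Rmin_l]).
assert (W23 : Cmod (w - z) < Rmin d2 d3) by (eapply Rlt_le_trans; [exact Hw|apply Rmin_r]).
assert (W2 : Cmod (w - z) < d2) by (eapply Rlt_le_trans; [exact W23|apply Rmin_l]).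
assert (W3 : Cmod (w - z) < d3) by (eapply Rlt_le_trans; [exact W23|apply Rmin_r]).
specialize (H1 w W1). specialize (H2 w W2). specialize (H3 w W3).
assert (H4 : Cmod (g w - g z) < 1) by (eapply Rlt_le_trans; [exact H3|apply Rmin_l]).
assert (H5 : Cmod (g w - g z) < e) by (eapply Rlt_le_trans; [exact H3|apply Rmin_r]).
replace (f w * g w - f z * g z - (L * g z + f z * M) * (w - z))%C
  with ((f w - f z - L * (w - z)) * g w + f z * (g w - g z - M * (w - z))
        + L * (g w - g z) * (w - z))%C by ring.
pose proof (Cmod_ge_0 (w - z)) as P4.
assert (G : Cmod (g w) <= K) by (pose proof (Cmod_sub_le (g w) (g z)); unfold K; lra).
assert (B1 : Cmod ((f w - f z - L * (w - z)) * g w) <= eps / 3 * Cmod (w - z)).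
{ rewrite Cmod_mult. rewrite <- HeK.
  replace (e * K * Cmod (w - z)) with (e * Cmod (w - z) * K) by ring.
  apply Rmult_le_compat; try apply Cmod_ge_0; assumption. }
assert (B2 : Cmod (f z * (g w - g z - M * (w - z))) <= eps / 3 * Cmod (w - z)).
{ rewrite Cmod_mult. rewrite <- HeK.
  replace (e * K * Cmod (w - z)) with (K * (e * Cmod (w - z))) by ring.
  apply Rmult_le_compat; try apply Cmod_ge_0; [unfold K; lra|assumption]. }
assert (B3 : Cmod (L * (g w - g z) * (w - z)) <= eps / 3 * Cmod (w - z)).
{ rewrite !Cmod_mult. rewrite <- HeK. apply Rmult_le_compat_r; [assumption|].
  rewrite (Rmult_comm e). apply Rmult_le_compat; try apply Cmod_ge_0; [unfold K; lra|lra]. }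
eapply Rle_trans; [apply Cmod_triangle|].
eapply Rle_trans; [apply Rplus_le_compat_r, Cmod_triangle|]. lra.
Qed.

Lemma cdiff_comp f g z L M : cdiff f (g z) L -> cdiff g z M ->
  cdiff (fun w => f (g w)) z (L * M)%C.
Proof.
intros Hf Hg eps He.
pose proof (Cmod_ge_0 L) as P1. pose proof (Cmod_ge_0 M) as P2.
set (e1 := eps / (2 * (Cmod M + 1))). set (e2 := eps / (2 * (Cmod L + 1))).
assert (He1 : 0 < e1) by (apply Rdiv_lt_0_compat; lra).
assert (He2 : 0 < e2) by (apply Rdiv_lt_0_compat; lra).
assert (E1 : e1 * (Cmod M + 1) = eps / 2) by (unfold e1; field; lra).
assert (E2 : (Cmod L + 1) * e2 = eps / 2) by (unfold e2; field; lra).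
destruct (Hf e1 He1) as [d1 [Hd1 H1]].
destruct (Hg e2 He2) as [d2 [Hd2 H2]].
destruct (cdiff_lip _ _ _ Hg) as [d3 [Hd3 H3]].
destruct (cdiff_ccont _ _ _ Hg d1 Hd1) as [d4 [Hd4 H4]].
exists (Rmin d2 (Rmin d3 d4)). split; [repeat apply Rmin_pos; assumption|]. intros w Hw.
assert (W2 : Cmod (w - z) < d2) by (eapply Rlt_le_trans; [exact Hw|apply Rmin_l]).
assert (W34 : Cmod (w - z) < Rmin d3 d4) by (eapply Rlt_le_trans; [exact Hw|apply Rmin_r]).
assert (W3 : Cmod (w - z) < d3) by (eapply Rlt_le_trans; [exact W34|apply Rmin_l]).
assert (W4 : Cmod (w - z) < d4) by (eapply Rlt_le_trans; [exact W34|apply Rmin_r]).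
specialize (H2 w W2). specialize (H3 w W3). specialize (H4 w W4). specialize (H1 _ H4).
replace (f (g w) - f (g z) - L * M * (w - z))%C
  with ((f (g w) - f (g z) - L * (g w - g z)) + L * (g w - g z - M * (w - z)))%C by ring.
eapply Rle_trans; [apply Cmod_triangle|]. rewrite (Cmod_mult L).
pose proof (Cmod_ge_0 (w - z)) as P4.
assert (B1 : e1 * Cmod (g w - g z) <= eps / 2 * Cmod (w - z)).
{ rewrite <- E1, Rmult_assoc. apply Rmult_le_compat_l; lra. }
assert (B2 : Cmod L * Cmod (g w - g z - M * (w - z)) <= eps / 2 * Cmod (w - z)).
{ rewrite <- E2, Rmult_assoc. apply Rmult_le_compat; try apply Cmod_ge_0; lra. }
lra.
Qed.

Lemma cdiff_Cinv (z : C) : z <> 0%C -> cdiff (fun w => / w)%C z (- / (z * z))%C.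
Proof.
intros Hz eps He. assert (Hz' : 0 < Cmod z) by (apply Cmod_gt_0; exact Hz).
set (m := Cmod z) in *.
exists (Rmin (m / 2) (eps * m ^ 3 / 2)).
assert (0 < m ^ 3) by (apply pow_lt; exact Hz').
split; [apply Rmin_pos; nra|]. intros w Hw.
assert (W1 : Cmod (w - z) < m / 2) by (eapply Rlt_le_trans; [exact Hw|apply Rmin_l]).
assert (W2 : Cmod (w - z) < eps * m ^ 3 / 2) by (eapply Rlt_le_trans; [exact Hw|apply Rmin_r]).
assert (Wm : m / 2 < Cmod w).
{ pose proof (Cmod_sub_le z w). rewrite Cmod_swap in H0. fold m in H0. lra. }
assert (Hw0 : w <> 0%C) by (intros ->; rewrite Cmod_0 in Wm; lra).
replace (/ w - / z - - / (z * z) * (w - z))%C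
  with ((w - z) * (w - z) * / (z * z * w))%C by (field; auto).
rewrite !Cmod_mult, Cmod_inv, !Cmod_mult by (repeat apply Cmult_neq_0; assumption).
fold m. pose proof (Cmod_ge_0 (w - z)) as P4. set (t := Cmod (w - z)) in *.
rewrite (Rmult_comm eps), Rmult_assoc. apply Rmult_le_compat_l; [exact P4|].
apply Rmult_le_reg_r with (m * m * Cmod w); [nra|].
rewrite Rmult_assoc, Rinv_l by nra.
apply Rle_trans with (eps * (m * m * (m / 2))); [simpl in W2; lra|].
apply Rmult_le_compat_l; [lra|]. apply Rmult_le_compat_l; nra.
Qed.

Lemma cdiff_shift f w z L : cdiff f (w + z)%C L -> cdiff (fun u => f (w + u)%C) z L.
Proof.
intros H. rewrite <- (Cmult_1_r L).
apply (cdiff_comp f (fun u => w + u)%C); [exact H|].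
rewrite <- (Cplus_0_l 1). apply cdiff_plus; [apply cdiff_const|apply cdiff_id].
Qed.

Lemma ccont_mult f g z : ccont f z -> ccont g z -> ccont (fun w => f w * g w)%C z.
Proof.
intros Hf Hg eps He.
pose proof (Cmod_ge_0 (f z)) as P1. pose proof (Cmod_ge_0 (g z)) as P2.
set (K := Cmod (f z) + Cmod (g z) + 1).
assert (HK : 0 < K) by (unfold K; lra).
set (e := eps / (2 * K)).
assert (He' : 0 < e) by (apply Rdiv_lt_0_compat; lra).
assert (HeK : e * K = eps / 2) by (unfold e; field; lra).
destruct (Hf e He') as [d1 [Hd1 H1]].
destruct (Hg (Rmin 1 e)) as [d2 [Hd2 H2]]; [apply Rmin_pos; lra|].
exists (Rmin d1 d2). split; [repeat apply Rmin_pos; assumption|]. intros w Hw.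
assert (W1 : Cmod (w - z) < d1) by (eapply Rlt_le_trans; [exact Hw|apply Rmin_l]).
assert (W2 : Cmod (w - z) < d2) by (eapply Rlt_le_trans; [exact Hw|apply Rmin_r]).
specialize (H1 w W1). specialize (H2 w W2).
assert (H4 : Cmod (g w - g z) < 1) by (eapply Rlt_le_trans; [exact H2|apply Rmin_l]).
assert (H5 : Cmod (g w - g z) < e) by (eapply Rlt_le_trans; [exact H2|apply Rmin_r]).
replace (f w * g w - f z * g z)%C
  with ((f w - f z) * g w + f z * (g w - g z))%C by ring.
eapply Rle_lt_trans; [apply Cmod_triangle|]. rewrite !Cmod_mult.
assert (G : Cmod (g w) <= K) by (pose proof (Cmod_sub_le (g w) (g z)); unfold K; lra).
assert (B1 : Cmod (f w - f z) * Cmod (g w) <= Cmod (f w - f z) * K)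
  by (apply Rmult_le_compat_l; [apply Cmod_ge_0|exact G]).
assert (B1' : Cmod (f w - f z) * K < e * K) by (apply Rmult_lt_compat_r; assumption).
assert (B2 : Cmod (f z) * Cmod (g w - g z) <= K * e).
{ apply Rmult_le_compat; try apply Cmod_ge_0; unfold K; lra. }
lra.
Qed.

Lemma ccont_minus f g z : ccont f z -> ccont g z -> ccont (fun w => f w - g w)%C z.
Proof.
intros Hf Hg eps He.
destruct (Hf (eps / 2)) as [d1 [Hd1 H1]]; [lra|].
destruct (Hg (eps / 2)) as [d2 [Hd2 H2]]; [lra|].
exists (Rmin d1 d2). split; [apply Rmin_pos; assumption|]. intros w Hw.
assert (W1 : Cmod (w - z) < d1) by (eapply Rlt_le_trans; [exact Hw|apply Rmin_l]).
assert (W2 : Cmod (w - z) < d2) by (eapply Rlt_le_trans; [exact Hw|apply Rmin_r]).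
specialize (H1 w W1). specialize (H2 w W2).
replace (f w - g w - (f z - g z))%C with ((f w - f z) + - (g w - g z))%C by ring.
eapply Rle_lt_trans; [apply Cmod_triangle|]. rewrite Cmod_opp. lra.
Qed.

Lemma ccont_comp f g z : ccont f (g z) -> ccont g z -> ccont (fun w => f (g w)) z.
Proof.
intros Hf Hg eps He. destruct (Hf eps He) as [d [Hd H]].
destruct (Hg d Hd) as [d' [Hd' H']]. exists d'. split; [exact Hd'|].
intros w Hw. apply H, H', Hw.
Qed.

Lemma ccont_const k z : ccont (fun _ => k) z.
Proof. exact (cdiff_ccont _ _ _ (cdiff_const k z)). Qed.

Lemma ccont_shift f w z : ccont f (w + z)%C -> ccont (fun u => f (w + u)%C) z.
Proof.
intros H. apply (ccont_comp f (fun u => w + u)%C); [exact H|].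
apply (cdiff_ccont _ _ (0 + 1)%C). apply cdiff_plus; [apply cdiff_const|apply cdiff_id].
Qed.

Lemma ccont_Cinv (z : C) : z <> 0%C -> ccont (fun w => / w)%C z.
Proof. intros H. exact (cdiff_ccont _ _ _ (cdiff_Cinv z H)). Qed.

(** * Restrictions to horizontal and vertical lines as curves in a real normed module *)

Lemma norm_CV (z : C) : @norm R_AbsRing CV z = Cmod z.
Proof.
change (sqrt (Rabs (fst z) ^ 2 + Rabs (snd z) ^ 2) = Cmod z).
unfold Cmod. f_equal. rewrite !pow2_abs. reflexivity.
Qed.

Lemma Cmod_hline (s t c : R) : Cmod ((s, c) - (t, c))%C = Rabs (s - t).
Proof.
replace ((s, c) - (t, c))%C with (RtoC (s - t)); [apply Cmod_R|].
unfold RtoC, Cminus, Cplus, Copp. simpl. f_equal; ring.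
Qed.

Lemma Cmod_vline (s t c : R) : Cmod ((c, s) - (c, t))%C = Rabs (s - t).
Proof.
replace ((c, s) - (c, t))%C with (Ci * RtoC (s - t))%C.
- rewrite Cmod_mult, Cmod_R, Cmod_Ci. ring.
- unfold Ci, RtoC, Cminus, Cplus, Copp, Cmult. simpl. f_equal; ring.
Qed.

Lemma continuous_CV (g : R -> C) (t : R) :
  (forall eps, 0 < eps -> exists delta, 0 < delta /\
    forall s, Rabs (s - t) < delta -> Cmod (g s - g t) < eps) ->
  continuous (g : R -> CV) t.
Proof.
intros H. apply (proj2 (filterlim_locally_ball_norm (U := CV) _ _)).
intros eps. destruct (H eps (cond_pos eps)) as [d [Hd H']].
exists (mkposreal d Hd). intros s Hs. unfold ball_norm. rewrite norm_CV. apply H', Hs.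
Qed.

Lemma continuous_hline h (x c : R) : ccont h (x, c) ->
  continuous ((fun t => h (t, c)) : R -> CV) x.
Proof.
intros H. apply continuous_CV. intros eps He. destruct (H eps He) as [d [Hd H']].
exists d. split; [exact Hd|]. intros s Hs. apply H'. rewrite Cmod_hline. exact Hs.
Qed.

Lemma continuous_vline h (c y : R) : ccont h (c, y) ->
  continuous ((fun t => Ci * h (c, t))%C : R -> CV) y.
Proof.
intros H. apply continuous_CV. intros eps He. destruct (H eps He) as [d [Hd H']].
exists d. split; [exact Hd|]. intros s Hs.
replace (Ci * h (c, s) - Ci * h (c, y))%C with (Ci * (h (c, s) - h (c, y)))%C by ring.
rewrite Cmod_mult, Cmod_Ci, Rmult_1_l. apply H'. rewrite Cmod_vline. exact Hs.
Qed.

Lemma is_derive_CV (g : R -> C) (t : R) (l : C) :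
  (forall eps, 0 < eps -> exists delta, 0 < delta /\
    forall s, Rabs (s - t) < delta ->
      Cmod (g s - g t - RtoC (s - t) * l) <= eps * Rabs (s - t)) ->
  is_derive (g : R -> CV) t l.
Proof.
intros H. split; [apply is_linear_scal_l|].
intros x Hx. assert (E : x = t) by (symmetry; apply (is_filter_lim_locally_unique _ _ Hx)).
subst x. intros eps. destruct (H eps (cond_pos eps)) as [d [Hd H']].
exists (mkposreal d Hd). intros s Hs.
specialize (H' s Hs).
change (@norm R_AbsRing CV (minus (minus (g s : CV) (g t)) (@scal R_AbsRing CV (s - t)%R l))
  <= eps * Rabs (s - t)).
rewrite norm_CV.
replace (minus (minus (g s : CV) (g t)) (@scal R_AbsRing CV (s - t)%R l))
  with (g s - g t - RtoC (s - t) * l)%C. exact H'.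
change (g s - g t - RtoC (s - t) * l = g s - g t - @scal R_AbsRing CV (s - t)%R l)%C.
f_equal. f_equal. destruct l as [l1 l2].
unfold RtoC, Cmult. cbn. unfold prod_scal. cbn. unfold mult. cbn. f_equal; ring.
Qed.

Lemma is_derive_hline h (x c : R) L : cdiff h (x, c) L ->
  is_derive ((fun t => h (t, c)) : R -> CV) x L.
Proof.
intros H. apply is_derive_CV. intros eps He. destruct (H eps He) as [d [Hd H']].
exists d. split; [exact Hd|]. intros s Hs.
replace (RtoC (s - x) * L)%C with (L * ((s, c) - (x, c)))%C.
- rewrite <- (Cmod_hline s x c). apply H'. rewrite Cmod_hline. exact Hs.
- rewrite Cmult_comm. f_equal. unfold RtoC, Cminus, Cplus, Copp. simpl. f_equal; ring.
Qed.

Lemma is_derive_vline h (c y : R) L : cdiff h (c, y) L ->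
  is_derive ((fun t => h (c, t)) : R -> CV) y (Ci * L)%C.
Proof.
intros H. apply is_derive_CV. intros eps He. destruct (H eps He) as [d [Hd H']].
exists d. split; [exact Hd|]. intros s Hs.
replace (RtoC (s - y) * (Ci * L))%C with (L * ((c, s) - (c, y)))%C.
- rewrite <- (Cmod_vline s y c). apply H'. rewrite Cmod_vline. exact Hs.
- rewrite (Cmult_comm Ci), Cmult_assoc, (Cmult_comm _ L), <- Cmult_assoc. f_equal.
  unfold RtoC, Ci, Cmult, Cminus, Cplus, Copp. simpl. f_equal; ring.
Qed.

(** * Contour integrals over rectangles and Goursat's theorem *)

Definition hint (h : C -> C) (c a b : R) : C := RInt ((fun x => h (x, c)) : R -> CV) a b.
(** The factor [Ci] comes from dz = i dy on a vertical side. *)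
Definition vint (h : C -> C) (c a b : R) : C := RInt ((fun y => Ci * h (c, y))%C : R -> CV) a b.

(* The contour integral of [h] along the positively oriented boundary of [a,b] x [c,d]. *)
Definition bd (h : C -> C) (a b c d : R) : C :=
  (hint h c a b + vint h b c d - hint h d a b - vint h a c d)%C.

Definition rcont (h : C -> C) (a b c d : R) : Prop :=
  forall x y, a <= x <= b -> c <= y <= d -> ccont h (x, y).

Definition bpt (a b c d x y : R) : Prop :=
  a <= x <= b /\ c <= y <= d /\ (x = a \/ x = b \/ y = c \/ y = d).

(** Continuity is asked on the contour alone, so that kernels with a pole inside the rectangle
    qualify. *)
Definition bcont (h : C -> C) (a b c d : R) : Prop :=
  forall x y, bpt a b c d x y -> ccont h (x, y).

Lemma ex_hint h c a b : a <= b -> (forall x, a <= x <= b -> ccont h (x, c)) ->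
  ex_RInt ((fun x => h (x, c)) : R -> CV) a b.
Proof.
intros Hab H. apply ex_RInt_continuous. intros x Hx.
rewrite Rmin_left, Rmax_right in Hx by assumption. apply continuous_hline, H, Hx.
Qed.

Lemma ex_vint h c a b : a <= b -> (forall y, a <= y <= b -> ccont h (c, y)) ->
  ex_RInt ((fun y => Ci * h (c, y))%C : R -> CV) a b.
Proof.
intros Hab H. apply ex_RInt_continuous. intros x Hx.
rewrite Rmin_left, Rmax_right in Hx by assumption. apply continuous_vline, H, Hx.
Qed.

Lemma bcont_sides h a b c d : a <= b -> c <= d -> bcont h a b c d ->
  (forall x, a <= x <= b -> ccont h (x, c)) /\ (forall x, a <= x <= b -> ccont h (x, d)) /\
  (forall y, c <= y <= d -> ccont h (a, y)) /\ (forall y, c <= y <= d -> ccont h (b, y)).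
Proof.
intros Hab Hcd H. repeat split; intros t Ht; apply H; unfold bpt;
  (split; [lra|split; [lra|tauto]]).
Qed.

Lemma rcont_bcont h a b c d : rcont h a b c d -> bcont h a b c d.
Proof. intros H x y [Hx [Hy _]]. apply H; assumption. Qed.

Lemma bd_minus f g a b c d : a <= b -> c <= d -> bcont f a b c d -> bcont g a b c d ->
  bd (fun z => f z - g z)%C a b c d = (bd f a b c d - bd g a b c d)%C.
Proof.
intros Hab Hcd Hf Hg.
apply bcont_sides in Hf as [F1 [F2 [F3 F4]]]; try assumption.
apply bcont_sides in Hg as [G1 [G2 [G3 G4]]]; try assumption.
assert (Hh : forall e, (forall x, a <= x <= b -> ccont f (x, e)) ->
  (forall x, a <= x <= b -> ccont g (x, e)) ->
  hint (fun z => f z - g z)%C e a b = (hint f e a b - hint g e a b)%C).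
{ intros e F G. exact (RInt_minus (V := CV) _ _ a b (ex_hint _ _ _ _ Hab F) (ex_hint _ _ _ _ Hab G)). }
assert (Hv : forall e, (forall x, c <= x <= d -> ccont f (e, x)) ->
  (forall x, c <= x <= d -> ccont g (e, x)) ->
  vint (fun z => f z - g z)%C e c d = (vint f e c d - vint g e c d)%C).
{ intros e F G. unfold vint at 1.
  transitivity (RInt (V := CV) (fun y => minus ((Ci * f (e, y))%C : CV) (Ci * g (e, y))%C) c d).
  - apply (RInt_ext (V := CV)). intros y _. change (Ci * (f (e, y) - g (e, y)) = Ci * f (e, y) - Ci * g (e, y))%C. ring.
  - exact (RInt_minus (V := CV) _ _ c d (ex_vint _ _ _ _ Hcd F) (ex_vint _ _ _ _ Hcd G)). }
unfold bd. rewrite (Hh c F1 G1), (Hh d F2 G2), (Hv a F3 G3), (Hv b F4 G4). ring.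
Qed.

(** [CV] is a module over the reals, so linearity for a complex factor goes through the real and
    imaginary parts. *)
Lemma RInt_Cscal (f : R -> CV) (k : C) a b : ex_RInt f a b ->
  RInt ((fun x => k * f x)%C : R -> CV) a b = (k * RInt f a b)%C.
Proof.
intros H. apply RInt_correct in H. apply is_RInt_unique.
apply (is_RInt_fct_extend_pair (U := R_NormedModule) (V := R_NormedModule)); simpl.
- apply (is_RInt_minus (V := R_NormedModule) (fun x => fst k * fst (f x)) (fun x => snd k * snd (f x))).
  + apply (is_RInt_scal (V := R_NormedModule) (fun x => fst (f x))).
    exact (is_RInt_fct_extend_fst (U := R_NormedModule) (V := R_NormedModule) _ _ _ _ H).
  + apply (is_RInt_scal (V := R_NormedModule) (fun x => snd (f x))).
    exact (is_RInt_fct_extend_snd (U := R_NormedModule) (V := R_NormedModule) _ _ _ _ H).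
- apply (is_RInt_plus (V := R_NormedModule) (fun x => fst k * snd (f x)) (fun x => snd k * fst (f x))).
  + apply (is_RInt_scal (V := R_NormedModule) (fun x => snd (f x))).
    exact (is_RInt_fct_extend_snd (U := R_NormedModule) (V := R_NormedModule) _ _ _ _ H).
  + apply (is_RInt_scal (V := R_NormedModule) (fun x => fst (f x))).
    exact (is_RInt_fct_extend_fst (U := R_NormedModule) (V := R_NormedModule) _ _ _ _ H).
Qed.

Lemma bd_scal f k a b c d : a <= b -> c <= d -> bcont f a b c d ->
  bd (fun z => k * f z)%C a b c d = (k * bd f a b c d)%C.
Proof.
intros Hab Hcd Hf.
apply bcont_sides in Hf as [F1 [F2 [F3 F4]]]; try assumption.
assert (Hh : forall e, (forall x, a <= x <= b -> ccont f (x, e)) ->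
  hint (fun z => k * f z)%C e a b = (k * hint f e a b)%C).
{ intros e F. exact (RInt_Cscal _ k a b (ex_hint _ _ _ _ Hab F)). }
assert (Hv : forall e, (forall x, c <= x <= d -> ccont f (e, x)) ->
  vint (fun z => k * f z)%C e c d = (k * vint f e c d)%C).
{ intros e F. unfold vint. rewrite <- (RInt_Cscal _ k c d (ex_vint _ _ _ _ Hcd F)).
  apply (RInt_ext (V := CV)). intros y _. change (Ci * (k * f (e, y)) = k * (Ci * f (e, y)))%C. ring. }
unfold bd. rewrite (Hh c F1), (Hh d F2), (Hv a F3), (Hv b F4). ring.
Qed.

Lemma bd_ext (f g : C -> C) a b c d : a <= b -> c <= d ->
  (forall x y, bpt a b c d x y -> f (x, y) = g (x, y)) ->
  bd f a b c d = bd g a b c d.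
Proof.
intros Hab Hcd H. assert (Hh : forall e, e = c \/ e = d -> hint f e a b = hint g e a b).
{ intros e He. apply (RInt_ext (V := CV)). intros t. rewrite Rmin_left, Rmax_right by assumption.
  intros Ht. apply H. unfold bpt. split; [lra|split; [lra|tauto]]. }
assert (Hv : forall e, e = a \/ e = b -> vint f e c d = vint g e c d).
{ intros e He. apply (RInt_ext (V := CV)). intros t. rewrite Rmin_left, Rmax_right by assumption.
  intros Ht. rewrite H; [reflexivity|]. unfold bpt. split; [lra|split; [lra|tauto]]. }
unfold bd. rewrite (Hh c), (Hh d), (Hv a), (Hv b) by tauto. reflexivity.
Qed.

Lemma hint_le h (g : R -> R) c a b : a <= b -> (forall x, a <= x <= b -> ccont h (x, c)) ->
  ex_RInt g a b -> (forall x, a <= x <= b -> Cmod (h (x, c)) <= g x) ->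
  Cmod (hint h c a b) <= RInt g a b.
Proof.
intros Hab H Hg Hle. rewrite <- norm_CV.
apply (norm_RInt_le (fun x => h (x, c) : CV) g a b); try assumption.
- intros x Hx. rewrite norm_CV. apply Hle, Hx.
- apply RInt_correct, (ex_hint _ _ _ _ Hab H).
- apply (RInt_correct g), Hg.
Qed.

Lemma vint_le h (g : R -> R) c a b : a <= b -> (forall x, a <= x <= b -> ccont h (c, x)) ->
  ex_RInt g a b -> (forall x, a <= x <= b -> Cmod (h (c, x)) <= g x) ->
  Cmod (vint h c a b) <= RInt g a b.
Proof.
intros Hab H Hg Hle. rewrite <- norm_CV.
apply (norm_RInt_le (fun x => Ci * h (c, x) : CV)%C g a b); try assumption.
- intros x Hx. rewrite norm_CV, Cmod_mult, Cmod_Ci, Rmult_1_l. apply Hle, Hx.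
- apply RInt_correct, (ex_vint _ _ _ _ Hab H).
- apply (RInt_correct g), Hg.
Qed.

Lemma Cmod_bd_le h a b c d : Cmod (bd h a b c d) <=
  Cmod (hint h c a b) + Cmod (vint h b c d) + Cmod (hint h d a b) + Cmod (vint h a c d).
Proof.
unfold bd, Cminus. eapply Rle_trans; [apply Cmod_triangle|]. rewrite Cmod_opp.
apply Rplus_le_compat_r. eapply Rle_trans; [apply Cmod_triangle|]. rewrite Cmod_opp.
apply Rplus_le_compat_r, Cmod_triangle.
Qed.

Lemma bd_bound h a b c d M : a <= b -> c <= d -> bcont h a b c d ->
  (forall x y, bpt a b c d x y -> Cmod (h (x, y)) <= M) ->
  Cmod (bd h a b c d) <= 2 * M * ((b - a) + (d - c)).
Proof.
intros Hab Hcd Hf HM.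
apply bcont_sides in Hf as [F1 [F2 [F3 F4]]]; try assumption.
assert (I1 : forall e, (forall x, a <= x <= b -> ccont h (x, e)) ->
  (forall x, a <= x <= b -> Cmod (h (x, e)) <= M) -> Cmod (hint h e a b) <= (b - a) * M).
{ intros e F G. rewrite <- (RInt_const (V := R_CompleteNormedModule) a b M : _ = (b - a) * M).
  apply hint_le; try assumption. apply ex_RInt_const. }
assert (I2 : forall e, (forall x, c <= x <= d -> ccont h (e, x)) ->
  (forall x, c <= x <= d -> Cmod (h (e, x)) <= M) -> Cmod (vint h e c d) <= (d - c) * M).
{ intros e F G. rewrite <- (RInt_const (V := R_CompleteNormedModule) c d M : _ = (d - c) * M).
  apply vint_le; try assumption. apply ex_RInt_const. }
eapply Rle_trans; [apply Cmod_bd_le|].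
replace (2 * M * (b - a + (d - c))) with ((b - a) * M + (d - c) * M + (b - a) * M + (d - c) * M) by ring.
assert (HM' : forall x y, a <= x <= b -> c <= y <= d -> x = a \/ x = b \/ y = c \/ y = d ->
  Cmod (h (x, y)) <= M) by (intros; apply HM; unfold bpt; tauto).
apply Rplus_le_compat; [apply Rplus_le_compat; [apply Rplus_le_compat|]|].
- apply (I1 c F1). intros t Ht. apply HM'; try lra; tauto.
- apply (I2 b F4). intros t Ht. apply HM'; try lra; tauto.
- apply (I1 d F2). intros t Ht. apply HM'; try lra; tauto.
- apply (I2 a F3). intros t Ht. apply HM'; try lra; tauto.
Qed.

(** The fundamental theorem on each side leaves differences of corner values of [H], which cancel
    around the contour. The primitive is asked for at boundary points, so a pole inside is allowed,
    as with 1/z^2. *)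
Lemma bd_prim H h a b c d : a <= b -> c <= d -> bcont h a b c d ->
  (forall x y, bpt a b c d x y -> cdiff H (x, y) (h (x, y))) ->
  bd h a b c d = 0.
Proof.
intros Hab Hcd Hf Hd.
apply bcont_sides in Hf as [F1 [F2 [F3 F4]]]; try assumption.
assert (I1 : forall e, (forall x, a <= x <= b -> ccont h (x, e)) ->
  (forall x, a <= x <= b -> cdiff H (x, e) (h (x, e))) -> hint h e a b = (H (b, e) - H (a, e))%C).
{ intros e F G. apply (is_RInt_unique (V := CV)).
  apply (is_RInt_derive (V := CV) (fun x => H (x, e)) (fun x => h (x, e)));
  intros x; rewrite Rmin_left, Rmax_right by assumption; intros Hx.
  - apply is_derive_hline, G, Hx.
  - apply continuous_hline, F, Hx. }
assert (I2 : forall e, (forall x, c <= x <= d -> ccont h (e, x)) ->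
  (forall x, c <= x <= d -> cdiff H (e, x) (h (e, x))) -> vint h e c d = (H (e, d) - H (e, c))%C).
{ intros e F G. apply (is_RInt_unique (V := CV)).
  apply (is_RInt_derive (V := CV) (fun x => H (e, x)) (fun x => Ci * h (e, x))%C);
  intros x; rewrite Rmin_left, Rmax_right by assumption; intros Hx.
  - apply is_derive_vline, G, Hx.
  - apply continuous_vline, F, Hx. }
assert (HM' : forall x y, a <= x <= b -> c <= y <= d -> x = a \/ x = b \/ y = c \/ y = d ->
  cdiff H (x, y) (h (x, y))) by (intros; apply Hd; unfold bpt; tauto).
unfold bd. rewrite (I1 c F1), (I1 d F2), (I2 a F3), (I2 b F4);
  try (intros t Ht; apply HM'; [lra|lra|tauto]).
ring.
Qed.

Lemma hint_Chasles h c a m b : a <= m <= b -> (forall x, a <= x <= b -> ccont h (x, c)) ->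
  hint h c a b = (hint h c a m + hint h c m b)%C.
Proof.
intros Hm H. symmetry.
apply (RInt_Chasles (V := CV) (fun x => h (x, c)) a m b); apply ex_hint; try lra;
intros; apply H; lra.
Qed.

Lemma vint_Chasles h c a m b : a <= m <= b -> (forall x, a <= x <= b -> ccont h (c, x)) ->
  vint h c a b = (vint h c a m + vint h c m b)%C.
Proof.
intros Hm H. symmetry.
apply (RInt_Chasles (V := CV) (fun x => Ci * h (c, x))%C a m b); apply ex_vint; try lra;
intros; apply H; lra.
Qed.

Lemma bd_quarter h a m b c n d : a <= m <= b -> c <= n <= d -> rcont h a b c d ->
  bd h a b c d = (bd h a m c n + bd h m b c n + bd h a m n d + bd h m b n d)%C.
Proof.
intros Hm Hn H. unfold bd.
rewrite (hint_Chasles h c a m b), (hint_Chasles h d a m b), (vint_Chasles h a c n d),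
  (vint_Chasles h b c n d); try assumption; try (intros; apply H; lra). ring.
Qed.

(** A quadratic polynomial is a primitive. In Goursat's argument this removes the first-order part
    of the function. *)
Lemma bd_affine A B z0 a b c d : a <= b -> c <= d ->
  bd (fun z => A + B * (z - z0))%C a b c d = 0.
Proof.
intros Hab Hcd.
assert (D : forall z, cdiff (fun z => z - z0)%C z 1).
{ intros z. rewrite <- (Cplus_0_r 1). apply cdiff_plus; [apply cdiff_id|apply cdiff_const]. }
apply (bd_prim (fun z => A * (z - z0) + B * / 2 * ((z - z0) * (z - z0)))%C); try assumption.
- intros x y _. apply (cdiff_ccont _ _ (0 + (0 * ((x, y) - z0) + B * 1)))%C.
  apply cdiff_plus; [apply cdiff_const|].
  apply (cdiff_mult (fun _ => B) (fun z => z - z0)%C); [apply cdiff_const|apply D].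
- intros x y _.
  replace (A + B * ((x, y) - z0))%C with
   ((0 * ((x, y) - z0) + A * 1) + (0 * (((x, y) - z0) * ((x, y) - z0)) + B * / 2 * (1 * ((x, y) - z0) + ((x, y) - z0) * 1)))%C.
  + apply cdiff_plus.
    * apply (cdiff_mult (fun _ => A) (fun z => z - z0)%C); [apply cdiff_const|apply D].
    * apply (cdiff_mult (fun _ => B * / 2)%C (fun z => (z - z0) * (z - z0))%C); [apply cdiff_const|].
      apply (cdiff_mult (fun z => z - z0)%C (fun z => z - z0)%C); apply D.
  + field.
Qed.

Lemma nested_intervals (u v : nat -> R) :
  (forall n, u n <= u (S n) /\ v (S n) <= v n /\ u n <= v n) ->
  exists x, forall n, u n <= x <= v n.
Proof.
intros H.
assert (Hu : forall n m, (n <= m)%nat -> u n <= u m /\ v m <= v n).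
{ intros n m Hnm. induction Hnm as [|m Hnm IH]; [lra|]. destruct (H m) as (? & ? & _). lra. }
assert (Huv : forall n m, u n <= v m).
{ intros n m. destruct (Hu n (max n m)) as [? _]; [lia|]. destruct (Hu m (max n m)) as [_ ?]; [lia|].
  destruct (H (max n m)) as (_ & _ & ?). lra. }
destruct (completeness (fun x => exists n, x = u n)) as [x [Hx1 Hx2]].
- exists (v O). intros x [n ->]. apply Huv.
- exists (u O). exists O. reflexivity.
- exists x. intros n. split; [apply Hx1; exists n; reflexivity|].
  apply Hx2. intros y [m ->]. apply Huv.
Qed.

(** Compactness in the form of bisection: if [P] failed, some quarter would fail, then a quarter of
    it, and so on; the failing rectangles shrink to a point, against the local hypothesis there. *)
Lemma rect_bisection (P : R -> R -> R -> R -> Prop) a b c d : a <= b -> c <= d ->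
  (forall a' b' c' d', a <= a' <= b' -> b' <= b -> c <= c' <= d' -> d' <= d ->
     let m := (a' + b') / 2 in let n := (c' + d') / 2 in
     P a' m c' n -> P m b' c' n -> P a' m n d' -> P m b' n d' -> P a' b' c' d') ->
  (forall x y, a <= x <= b -> c <= y <= d -> exists delta, 0 < delta /\
     forall a' b' c' d', a <= a' <= x -> x <= b' <= b -> c <= c' <= y -> y <= d' <= d ->
       b' - a' < delta -> d' - c' < delta -> P a' b' c' d') ->
  P a b c d.
Proof.
intros Hab Hcd Hq Hloc. apply NNPP. intros HP.
set (inv := fun q : (R * R) * (R * R) =>
  let '((a', b'), (c', d')) := q in
  a <= a' <= b' /\ b' <= b /\ c <= c' <= d' /\ d' <= d /\ ~ P a' b' c' d').
assert (Hstep : forall q, inv q -> exists q', inv q' /\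
  (let '((a', b'), (c', d')) := q in let '((a2, b2), (c2, d2)) := q' in
   a' <= a2 /\ b2 <= b' /\ c' <= c2 /\ d2 <= d' /\
   b2 - a2 = (b' - a') / 2 /\ d2 - c2 = (d' - c') / 2)).
{ intros [[a' b'] [c' d']] (H1 & H2 & H3 & H4 & H5).
  set (m := (a' + b') / 2). set (n := (c' + d') / 2).
  assert (a' <= m <= b') by (unfold m; lra). assert (c' <= n <= d') by (unfold n; lra).
  destruct (classic (P a' m c' n)) as [Q1|Q1];
  [destruct (classic (P m b' c' n)) as [Q2|Q2];
  [destruct (classic (P a' m n d')) as [Q3|Q3];
  [destruct (classic (P m b' n d')) as [Q4|Q4]|]|]|].
  - exfalso. apply H5. apply Hq; assumption.
  - exists ((m, b'), (n, d')). unfold inv. repeat split; try lra; try assumption; unfold m, n; lra.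
  - exists ((a', m), (n, d')). unfold inv. repeat split; try lra; try assumption; unfold m, n; lra.
  - exists ((m, b'), (c', n)). unfold inv. repeat split; try lra; try assumption; unfold m, n; lra.
  - exists ((a', m), (c', n)). unfold inv. repeat split; try lra; try assumption; unfold m, n; lra. }
assert (Hq0 : inv ((a, b), (c, d))) by (unfold inv; repeat split; try lra; assumption).
(* Choosing on the subtype of failing rectangles keeps the proof of failure with each rectangle, so
   the choice can be iterated. *)
assert (HF : exists F : {q | inv q} -> {q | inv q}, forall q,
  let '((a', b'), (c', d')) := proj1_sig q in let '((a2, b2), (c2, d2)) := proj1_sig (F q) in
   a' <= a2 /\ b2 <= b' /\ c' <= c2 /\ d2 <= d' /\
   b2 - a2 = (b' - a') / 2 /\ d2 - c2 = (d' - c') / 2).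
{ apply (functional_choice (fun q q' : {q | inv q} =>
    let '((a', b'), (c', d')) := proj1_sig q in let '((a2, b2), (c2, d2)) := proj1_sig q' in
    a' <= a2 /\ b2 <= b' /\ c' <= c2 /\ d2 <= d' /\
    b2 - a2 = (b' - a') / 2 /\ d2 - c2 = (d' - c') / 2)).
  intros [q Hq']. destruct (Hstep q Hq') as [q' [H1 H2]]. exists (exist _ q' H1). exact H2. }
destruct HF as [F HF].
set (s := fix s n := match n with O => exist inv _ Hq0 | S n => F (s n) end).
set (An := fun n => fst (fst (proj1_sig (s n)))). set (Bn := fun n => snd (fst (proj1_sig (s n)))).
set (Cn := fun n => fst (snd (proj1_sig (s n)))). set (Dn := fun n => snd (snd (proj1_sig (s n)))).
assert (Hinv : forall n, a <= An n <= Bn n /\ Bn n <= b /\ c <= Cn n <= Dn n /\ Dn n <= d /\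
  ~ P (An n) (Bn n) (Cn n) (Dn n)).
{ intros n. unfold An, Bn, Cn, Dn. destruct (s n) as [[[a' b'] [c' d']] H]. exact H. }
assert (HS : forall n, An n <= An (S n) /\ Bn (S n) <= Bn n /\ Cn n <= Cn (S n) /\ Dn (S n) <= Dn n /\
  Bn (S n) - An (S n) = (Bn n - An n) / 2 /\ Dn (S n) - Cn (S n) = (Dn n - Cn n) / 2).
{ intros n. specialize (HF (s n)). change (F (s n)) with (s (S n)) in HF.
  unfold An, Bn, Cn, Dn.
  destruct (s n) as [[[a' b'] [c' d']] H]. destruct (s (S n)) as [[[a2 b2] [c2 d2]] H2]. exact HF. }
destruct (nested_intervals An Bn) as [x Hx].
{ intros n. destruct (HS n) as (? & ? & _). destruct (Hinv n) as (? & _). lra. }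
destruct (nested_intervals Cn Dn) as [y Hy].
{ intros n. destruct (HS n) as (_ & _ & ? & ? & _). destruct (Hinv n) as (_ & _ & ? & _). lra. }
assert (HW : forall n, Bn n - An n = (b - a) * (/ 2) ^ n /\ Dn n - Cn n = (d - c) * (/ 2) ^ n).
{ induction n as [|n [IH1 IH2]].
  - unfold An, Bn, Cn, Dn. simpl. lra.
  - destruct (HS n) as (_ & _ & _ & _ & E1 & E2). rewrite E1, E2, IH1, IH2. simpl. lra. }
destruct (Hloc x y) as [delta [Hdelta HL]].
{ specialize (Hx O). destruct (Hinv O) as (? & ? & _). lra. }
{ specialize (Hy O). destruct (Hinv O) as (_ & _ & ? & ? & _). lra. }
assert (HT : exists n, (b - a) * (/ 2) ^ n < delta /\ (d - c) * (/ 2) ^ n < delta).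
(* Dividing by the sum of both widths handles them together; the 1 keeps the denominator positive
   for a degenerate rectangle. *)
{ destruct (pow_lt_1_zero (/ 2)) with (y := delta / (b - a + (d - c) + 1)) as [N HN].
  - rewrite Rabs_pos_eq; lra.
  - apply Rdiv_lt_0_compat; lra.
  - exists N. specialize (HN N (le_n _)).
    assert (0 < (/ 2) ^ N) by (apply pow_lt; lra).
    rewrite Rabs_pos_eq in HN by lra.
    apply (Rmult_lt_compat_r (b - a + (d - c) + 1)) in HN; [|lra].
    unfold Rdiv in HN. rewrite Rmult_assoc, Rinv_l in HN by lra.
    split; nra. }
destruct HT as [n [T1 T2]]. destruct (HW n) as [W1 W2].
destruct (Hinv n) as (I1 & I2 & I3 & I4 & I5). specialize (Hx n). specialize (Hy n).
apply I5, HL; lra.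
Qed.

Lemma goursat h a b c d : a <= b -> c <= d ->
  (forall x y, a <= x <= b -> c <= y <= d -> exists L, cdiff h (x, y) L) ->
  bd h a b c d = 0.
Proof.
intros Hab Hcd Hh.
assert (Hc : rcont h a b c d).
{ intros x y Hx Hy. destruct (Hh x y Hx Hy) as [L HL]. exact (cdiff_ccont _ _ _ HL). }
apply Cmod_eq_0.
(* A quadratic bound is what bisection preserves: each quarter has half the half-perimeter, so the
   four bounds add up exactly to the bound for the whole. *)
assert (K : forall eps, 0 < eps -> Cmod (bd h a b c d) <= eps * ((b - a) + (d - c)) ^ 2).
{ intros eps He.
  apply (rect_bisection (fun a b c d => Cmod (bd h a b c d) <= eps * ((b - a) + (d - c)) ^ 2));
    try assumption.
  - intros a' b' c' d' H1 H2 H3 H4 m n Q1 Q2 Q3 Q4.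
    rewrite (bd_quarter h a' m b' c' n d'); try (unfold m, n; lra).
    2: { intros x y Hx Hy. apply Hc; lra. }
    eapply Rle_trans; [apply Cmod_triangle|].
    eapply Rle_trans; [apply Rplus_le_compat_r, Cmod_triangle|].
    eapply Rle_trans; [apply Rplus_le_compat_r, Rplus_le_compat_r, Cmod_triangle|].
    replace (eps * (b' - a' + (d' - c')) ^ 2) with
      (eps * (m - a' + (n - c')) ^ 2 + eps * (b' - m + (n - c')) ^ 2 +
       eps * (m - a' + (d' - n)) ^ 2 + eps * (b' - m + (d' - n)) ^ 2) by (unfold m, n; field).
    lra.
  - intros x y Hx Hy. destruct (Hh x y Hx Hy) as [L HL].
    (* With half-perimeter p, the remainder is at most (eps / 2) p on a contour of length 2 p, which
       gives eps p^2. Sides shorter than [dl / 2] ensure p < [dl]. *)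
    destruct (HL (eps / 2)) as [dl [Hdl H]]; [lra|].
    exists (dl / 2). split; [lra|]. intros a' b' c' d' Ha Hb Hc' Hd Hw1 Hw2.
    set (z := (x, y) : C).
    assert (Hb' : bcont h a' b' c' d') by (apply rcont_bcont; intros u v Hu Hv; apply Hc; lra).
    assert (Haff : forall u, ccont (fun w => h z + L * (w - z))%C u).
    { intros u. apply (cdiff_ccont _ _ (0 + (0 * (u - z) + L * (1 + 0)))%C).
      apply cdiff_plus; [apply cdiff_const|].
      apply (cdiff_mult (fun _ => L) (fun w => w - z)%C); [apply cdiff_const|].
      apply cdiff_plus; [apply cdiff_id|apply cdiff_const]. }
    (* The affine part has zero contour integral, so only the differentiability remainder at [z]
       counts. *)
    assert (E : bd h a' b' c' d' = bd (fun w => h w - (h z + L * (w - z)))%C a' b' c' d').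
    { rewrite bd_minus, bd_affine; try lra; [ring|exact Hb'|]. intros u v _. apply Haff. }
    rewrite E.
    replace (eps * (b' - a' + (d' - c')) ^ 2)
      with (2 * (eps / 2 * (b' - a' + (d' - c'))) * (b' - a' + (d' - c'))) by field.
    apply bd_bound; try lra.
    { intros u v Hu. apply ccont_minus; [apply Hb', Hu|apply Haff]. }
    intros u v (Hu & Hv & _).
    assert (Hm : Cmod ((u, v) - z) <= b' - a' + (d' - c')).
    { replace ((u, v) - z)%C with (((u, v) - (x, v)) + ((x, v) - z))%C by ring.
      eapply Rle_trans; [apply Cmod_triangle|].
      unfold z. rewrite Cmod_hline, Cmod_vline. apply Rplus_le_compat; apply Rabs_le; lra. }
    replace (h (u, v) - (h z + L * ((u, v) - z)))%C with (h (u, v) - h z - L * ((u, v) - z))%C by ring.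
    eapply Rle_trans; [apply H; fold z; lra|]. fold z. apply Rmult_le_compat_l; lra. }
destruct (Rle_lt_or_eq_dec _ _ (Cmod_ge_0 (bd h a b c d))) as [Hp|He]; [|symmetry; exact He].
exfalso. set (B := Cmod (bd h a b c d)) in *. set (W := (b - a + (d - c)) ^ 2) in *.
assert (0 <= W) by (apply pow2_ge_0).
specialize (K (B / (2 * (W + 1))) ltac:(apply Rdiv_lt_0_compat; lra)).
assert (B / (2 * (W + 1)) * W < B); [|lra].
replace (B / (2 * (W + 1)) * W) with (B * (W / (2 * (W + 1)))) by (field; lra).
rewrite <- (Rmult_1_r B) at 2. apply Rmult_lt_compat_l; [exact Hp|].
apply Rmult_lt_reg_r with (2 * (W + 1)); [lra|]. unfold Rdiv. rewrite Rmult_assoc, Rinv_l; lra.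
Qed.

(** * Cauchy's formulas on squares *)

Definition holo (f fp : C -> C) : Prop := forall z, Cmod z < 1 -> cdiff f z (fp z).

Definition sqbd (h : C -> C) (S : R) : C := bd h (- S) S (- S) S.

Definition twopii : C := (0, 2 * PI).

Lemma sqbd_point_pos S x y : 0 < S -> bpt (- S) S (- S) S x y -> S <= Cmod (x, y).
Proof.
intros HS (Hx & Hy & H).
assert (Rabs x = S \/ Rabs y = S) as [E|E].
{ destruct H as [ -> |[ -> |[ -> | -> ]]]; rewrite ?Rabs_Ropp, ?(Rabs_pos_eq S) by lra; tauto. }
- rewrite <- E. eapply Rle_trans; [apply Rmax_l|apply (Rmax_Cmod (x, y))].
- rewrite <- E. eapply Rle_trans; [apply Rmax_r|apply (Rmax_Cmod (x, y))].
Qed.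

(** The constant 3/2 is a rational upper bound for sqrt 2, since 9/4 > 2; it reappears in every
    condition that keeps a square inside the disc. *)
Lemma square_point_le S x y : - S <= x <= S -> - S <= y <= S -> Cmod (x, y) <= 3 / 2 * S.
Proof.
intros Hx Hy. unfold Cmod; simpl fst; simpl snd.
rewrite <- (sqrt_pow2 (3 / 2 * S)) by lra. apply sqrt_le_1_alt. nra.
Qed.

Lemma Cmod_pos_neq0 (z : C) : 0 < Cmod z -> z <> 0%C.
Proof. intros H ->. rewrite Cmod_0 in H. lra. Qed.

(** The frame between the squares is cut into two full-height columns and two blocks above and below
    the inner square. Goursat's theorem kills each piece and the common edges cancel. *)
Lemma square_shrink h s S : 0 < s <= S ->
  (forall x y, - S <= x <= S -> - S <= y <= S -> s <= Rabs x \/ s <= Rabs y ->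
     exists L, cdiff h (x, y) L) ->
  sqbd h S = sqbd h s.
Proof.
intros [Hs HsS] Hh. unfold sqbd.
assert (R1 : forall x, x <= - s -> s <= Rabs x) by (intros x Hx; rewrite Rabs_left1; lra).
assert (R2 : forall x, s <= x -> s <= Rabs x) by (intros x Hx; rewrite Rabs_pos_eq; lra).
assert (Hc : forall x y, - S <= x <= S -> - S <= y <= S -> s <= Rabs x \/ s <= Rabs y -> ccont h (x, y)).
{ intros x y Hx Hy H. destruct (Hh x y Hx Hy H) as [L HL]. exact (cdiff_ccont _ _ _ HL). }
assert (G1 : bd h (- S) (- s) (- S) S = 0).
{ apply goursat; try lra. intros x y Hx Hy. apply Hh; try lra. left. apply R1; lra. }
assert (G2 : bd h s S (- S) S = 0).
{ apply goursat; try lra. intros x y Hx Hy. apply Hh; try lra. left. apply R2; lra. }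
assert (G3 : bd h (- s) s (- S) (- s) = 0).
{ apply goursat; try lra. intros x y Hx Hy. apply Hh; try lra. right. apply R1; lra. }
assert (G4 : bd h (- s) s s S = 0).
{ apply goursat; try lra. intros x y Hx Hy. apply Hh; try lra. right. apply R2; lra. }
assert (E : bd h (- S) S (- S) S = (bd h (- s) s (- s) s + bd h (- S) (- s) (- S) S
  + bd h s S (- S) S + bd h (- s) s (- S) (- s) + bd h (- s) s s S)%C).
{ unfold bd.
  rewrite (hint_Chasles h (- S) (- S) (- s) S), (hint_Chasles h (- S) (- s) s S),
    (hint_Chasles h S (- S) (- s) S), (hint_Chasles h S (- s) s S),
    (vint_Chasles h (- s) (- S) (- s) S), (vint_Chasles h (- s) (- s) s S),
    (vint_Chasles h s (- S) (- s) S), (vint_Chasles h s (- s) s S); try lra; [ring|..];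
  intros t Ht; apply Hc; try lra; first [left; solve [apply R1; lra|apply R2; lra] | right; solve [apply R1; lra|apply R2; lra]]. }
rewrite E, G1, G2, G3, G4. ring.
Qed.

(** Removable singularity when z h(z) tends to 0: on a small square of half-size s the integrand is
    at most eps / s, and the contour has length 8 s. *)
Lemma sqbd_removable h S : 0 < S ->
  (forall x y, - S <= x <= S -> - S <= y <= S -> (x, y) <> RtoC 0 -> exists L, cdiff h (x, y) L) ->
  (forall eps, 0 < eps -> exists delta, 0 < delta /\ forall z, 0 < Cmod z < delta ->
     Cmod z * Cmod (h z) <= eps) ->
  sqbd h S = 0.
Proof.
intros HS Hh Hr. apply Cmod_eq_0.
assert (K : forall eps, 0 < eps -> Cmod (sqbd h S) <= 8 * eps).
{ intros eps He. destruct (Hr eps He) as [dl [Hdl H]].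
  (* Corners have modulus at most (3/2) s, hence below [dl]. *)
  set (s := Rmin S (dl / 2)). assert (Hs : 0 < s) by (apply Rmin_pos; lra).
  assert (Hs1 : s <= S) by apply Rmin_l. assert (Hs2 : s <= dl / 2) by apply Rmin_r.
  rewrite (square_shrink h s S).
  2: lra.
  2: { intros x y Hx Hy Hxy. apply Hh; try assumption. intros E. injection E as -> ->.
       rewrite Rabs_R0 in Hxy. lra. }
  unfold sqbd. eapply Rle_trans; [apply (bd_bound h _ _ _ _ (eps / s)); try lra|].
  - intros x y Hb. pose proof (sqbd_point_pos s x y Hs Hb) as Hp. destruct Hb as (Hx & Hy & _).
    destruct (Hh x y) as [L HL]; try lra.
    { apply Cmod_pos_neq0. lra. }
    exact (cdiff_ccont _ _ _ HL).
  - intros x y Hb. pose proof (sqbd_point_pos s x y Hs Hb) as Hp. destruct Hb as (Hx & Hy & _).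
    pose proof (square_point_le s x y Hx Hy) as Hq.
    apply Rmult_le_reg_l with s; [exact Hs|].
    replace (s * (eps / s)) with eps by (field; lra).
    eapply Rle_trans; [|apply (H (x, y)); lra].
    apply Rmult_le_compat_r; [apply Cmod_ge_0|exact Hp].
  - right. field. lra. }
destruct (Rle_lt_or_eq_dec _ _ (Cmod_ge_0 (sqbd h S))) as [Hp|He]; [|symmetry; exact He].
exfalso. specialize (K (Cmod (sqbd h S) / 16) ltac:(lra)). lra.
Qed.

(** This kernel and the arctangent one are, up to sign, the two components of dz/z along a side of a
    square. *)
Lemma RInt_odd_kernel S c : c <> 0 -> is_RInt (fun t => t / (t ^ 2 + c ^ 2)) (- S) S 0.
Proof.
intros Hc. assert (Hp : forall t, 0 < t ^ 2 + c ^ 2) by (intros t; nra).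
replace 0 with (minus (ln (S ^ 2 + c ^ 2) / 2) (ln ((- S) ^ 2 + c ^ 2) / 2)).
- apply (is_RInt_derive (V := R_CompleteNormedModule) (fun t => ln (t ^ 2 + c ^ 2) / 2)).
  + intros t _. auto_derive; [apply Hp|]. field. specialize (Hp t). lra.
  + intros t _. apply (ex_derive_continuous (V := R_NormedModule)).
    auto_derive. specialize (Hp t). lra.
- replace ((- S) ^ 2) with (S ^ 2) by ring. apply Rminus_diag_eq. reflexivity.
Qed.

Lemma RInt_arctan_kernel S c : c <> 0 ->
  is_RInt (fun t => c / (t ^ 2 + c ^ 2)) (- S) S (2 * atan (S / c)).
Proof.
intros Hc. assert (Hp : forall t, 0 < t ^ 2 + c ^ 2) by (intros t; nra).
replace (2 * atan (S / c)) with (minus (atan (S / c)) (atan (- S / c))).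
- apply (is_RInt_derive (V := R_CompleteNormedModule) (fun t => atan (t / c))).
  + intros t _. auto_derive; [exact I|]. field. specialize (Hp t). split; [lra|nra].
  + intros t _. apply (ex_derive_continuous (V := R_NormedModule)).
    auto_derive. specialize (Hp t). lra.
- replace (- S / c) with (- (S / c)) by (field; lra). rewrite atan_opp.
  change (atan (S / c) - - atan (S / c) = 2 * atan (S / c)). ring.
Qed.

(** Each side is seen from the centre under a right angle and contributes i PI / 2; a branch of the
    logarithm is avoided. *)
Lemma sqbd_Cinv S : 0 < S -> sqbd (fun z => / z)%C S = twopii.
Proof.
intros HS.
assert (A1 : atan (S / S) = PI / 4) by (rewrite Rdiv_diag by lra; apply atan_1).
assert (A2 : atan (S / - S) = - (PI / 4)).
{ replace (S / - S) with (- (1)) by (field; lra). rewrite atan_opp, atan_1. reflexivity. }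
assert (Hh : forall c, c <> 0 -> hint (fun z => / z)%C c (- S) S = (0, - (2 * atan (S / c)))).
{ intros c Hc. apply (is_RInt_unique (V := CV)).
  apply (is_RInt_fct_extend_pair (U := R_NormedModule) (V := R_NormedModule)); simpl.
  - apply (is_RInt_ext (fun t => t / (t ^ 2 + c ^ 2))); [reflexivity|]. apply RInt_odd_kernel, Hc.
  - apply (is_RInt_ext (fun t => opp (c / (t ^ 2 + c ^ 2)))).
    + intros t _. change (- (c / (t ^ 2 + c ^ 2)) = - c / (t * (t * 1) + c * (c * 1))).
      field. nra.
    + apply (is_RInt_opp (V := R_NormedModule)), RInt_arctan_kernel, Hc. }
assert (Hv : forall c, c <> 0 -> vint (fun z => / z)%C c (- S) S = (0, 2 * atan (S / c))).
{ intros c Hc. apply (is_RInt_unique (V := CV)).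
  apply (is_RInt_fct_extend_pair (U := R_NormedModule) (V := R_NormedModule)); simpl.
  - apply (is_RInt_ext (fun t => t / (t ^ 2 + c ^ 2))); [|apply RInt_odd_kernel, Hc].
    intros t _. simpl. field. nra.
  - apply (is_RInt_ext (fun t => c / (t ^ 2 + c ^ 2))); [|apply RInt_arctan_kernel, Hc].
    intros t _. simpl. field. nra. }
unfold sqbd, bd. rewrite (Hh S), (Hh (- S)), (Hv S), (Hv (- S)), A1, A2 by lra.
unfold twopii, Cminus, Cplus, Copp. simpl. f_equal; field.
Qed.

Lemma sqbd_Cinv_sq S : 0 < S -> sqbd (fun z => / (z * z))%C S = 0.
Proof.
intros HS. unfold sqbd.
assert (Hn : forall x y, bpt (- S) S (- S) S x y -> ((x, y) : C) <> 0%C).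
{ intros x y Hb. apply Cmod_pos_neq0. pose proof (sqbd_point_pos S x y HS Hb). lra. }
apply (bd_prim (fun z => - (1) * / z)%C); try lra.
- intros x y Hb. apply (ccont_comp (fun z => / z)%C (fun z => z * z)%C).
  + apply ccont_Cinv, Cmult_neq_0; apply Hn, Hb.
  + apply (ccont_mult (fun z => z) (fun z => z)); exact (cdiff_ccont _ _ _ (cdiff_id _)).
- intros x y Hb. pose proof (Hn x y Hb) as H.
  replace (/ ((x, y) * (x, y)))%C with (0 * / (x, y) + - (1) * - / ((x, y) * (x, y)))%C by ring.
  apply (cdiff_mult (fun _ => - (1))%C (fun z => / z)%C); [apply cdiff_const|apply cdiff_Cinv, H].
Qed.

Lemma square_in_disc (w : C) S x y : Cmod w + 3 / 2 * S < 1 -> - S <= x <= S -> - S <= y <= S ->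
  Cmod (w + (x, y))%C < 1.
Proof.
intros H Hx Hy. pose proof (square_point_le S x y Hx Hy).
pose proof (Cmod_triangle w (x, y)). lra.
Qed.

(** Subtracting the first-order Taylor polynomial before dividing by z^2 leaves a removable
    singularity. What remains is f(w)/z^2, which integrates to 0, and f'(w)/z. The formula for f'
    comes out at once, without differentiation under an integral. *)
Lemma cauchy_derivative f fp (w : C) S : holo f fp -> 0 < S -> Cmod w + 3 / 2 * S < 1 ->
  sqbd (fun z => f (w + z)%C * / (z * z))%C S = (fp w * twopii)%C.
Proof.
intros Hf HS Hw.
assert (Hn : forall x y, bpt (- S) S (- S) S x y -> ((x, y) : C) <> 0%C).
{ intros x y Hb. apply Cmod_pos_neq0. pose proof (sqbd_point_pos S x y HS Hb). lra. }
assert (D2 : forall z : C, z <> 0%C -> cdiff (fun z => / (z * z))%C z (- / (z * z * (z * z)) * (1 * z + z * 1))%C).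
{ intros z Hz. apply (cdiff_comp (fun z => / z)%C (fun z => z * z)%C).
  - apply cdiff_Cinv, Cmult_neq_0; assumption.
  - apply (cdiff_mult (fun z => z) (fun z => z)); apply cdiff_id. }
assert (Df : forall x y, - S <= x <= S -> - S <= y <= S ->
  cdiff (fun z => f (w + z)%C)%C (x, y) (fp (w + (x, y))%C)).
{ intros x y Hx Hy. apply cdiff_shift, Hf, (square_in_disc w S); assumption. }
assert (R0 : sqbd (fun z => (f (w + z)%C + (- f w + - fp w * z)) * / (z * z))%C S = 0).
{ apply sqbd_removable; [exact HS|..].
  - intros x y Hx Hy Hz. eexists.
    apply (cdiff_mult (fun z => f (w + z)%C + (- f w + - fp w * z))%C (fun z => / (z * z))%C);
      [|apply D2, Hz].
    apply (cdiff_plus (fun z => f (w + z)%C)%C (fun z => - f w + - fp w * z)%C); [apply Df; assumption|].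
    apply (cdiff_plus (fun _ => - f w)%C (fun z => - fp w * z)%C); [apply cdiff_const|].
    apply (cdiff_mult (fun _ => - fp w)%C (fun z => z)); [apply cdiff_const|apply cdiff_id].
  (* After clearing the powers of |z|, the required smallness is the definition of the derivative at
     [w]. *)
  - intros eps He. destruct (Hf w ltac:(lra) eps He) as [dl [Hdl H]]. exists dl. split; [exact Hdl|].
    intros z [Hz1 Hz2]. specialize (H (w + z)%C).
    replace (w + z - w)%C with z in H by ring. specialize (H Hz2).
    rewrite Cmod_mult, Cmod_inv, Cmod_mult by (apply Cmult_neq_0; apply Cmod_pos_neq0; assumption).
    replace (f (w + z)%C + (- f w + - fp w * z))%C with (f (w + z)%C - f w - fp w * z)%C by ring.
    apply Rmult_le_reg_r with (Cmod z); [exact Hz1|].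
    replace (Cmod z * (Cmod (f (w + z)%C - f w - fp w * z) * / (Cmod z * Cmod z)) * Cmod z)
      with (Cmod (f (w + z)%C - f w - fp w * z)) by (field; lra).
    exact H. }
assert (C2 : bcont (fun z => / (z * z))%C (- S) S (- S) S).
{ intros x y Hb. exact (cdiff_ccont _ _ _ (D2 _ (Hn x y Hb))). }
assert (C1 : bcont (fun z => / z)%C (- S) S (- S) S).
{ intros x y Hb. apply ccont_Cinv, Hn, Hb. }
assert (C0 : bcont (fun z => f (w + z)%C * / (z * z))%C (- S) S (- S) S).
{ intros x y Hb. apply (ccont_mult (fun z => f (w + z)%C)%C (fun z => / (z * z))%C); [|apply C2, Hb].
  destruct Hb as (Hx & Hy & _). exact (cdiff_ccont _ _ _ (Df x y Hx Hy)). }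
assert (C2' : bcont (fun z => f w * / (z * z))%C (- S) S (- S) S).
{ intros x y Hb. apply (ccont_mult (fun _ => f w) (fun z => / (z * z))%C); [apply ccont_const|apply C2, Hb]. }
assert (C1' : bcont (fun z => fp w * / z)%C (- S) S (- S) S).
{ intros x y Hb. apply (ccont_mult (fun _ => fp w) (fun z => / z)%C); [apply ccont_const|apply C1, Hb]. }
assert (E : sqbd (fun z => (f (w + z)%C + (- f w + - fp w * z)) * / (z * z))%C S =
  (sqbd (fun z => f (w + z)%C * / (z * z))%C S - f w * sqbd (fun z => / (z * z))%C S
   - fp w * sqbd (fun z => / z)%C S)%C).
{ unfold sqbd.
  rewrite <- (bd_scal _ (f w)), <- (bd_scal _ (fp w)), <- bd_minus, <- bd_minus; try assumption; try lra.
  - apply bd_ext; try lra. intros x y Hb. field. apply Hn, Hb.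
  - intros x y Hb. apply (ccont_minus (fun z => f (w + z)%C * / (z * z))%C (fun z => f w * / (z * z))%C);
      [apply C0, Hb|apply C2', Hb]. }
rewrite R0, sqbd_Cinv, sqbd_Cinv_sq in E by exact HS.
replace (sqbd (fun z => f (w + z)%C * / (z * z))%C S) with
 (sqbd (fun z : C => f (w + z)%C * / (z * z)) S - f w * 0 - fp w * twopii
   + fp w * twopii)%C by ring.
rewrite <- E. ring.
Qed.

(** * Cauchy estimates and continuity of the derivative *)

Lemma Cmod_twopii : Cmod twopii = 2 * PI.
Proof.
pose proof PI_RGT_0. unfold Cmod, twopii. simpl fst. simpl snd.
replace (0 ^ 2 + (2 * PI) ^ 2) with ((2 * PI) ^ 2) by ring. apply sqrt_pow2. lra.
Qed.

Lemma Cmod_fst (z : C) : Rabs (fst z) <= Cmod z.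
Proof. eapply Rle_trans; [apply Rmax_l|apply Rmax_Cmod]. Qed.

Lemma Cmod_snd (z : C) : Rabs (snd z) <= Cmod z.
Proof. eapply Rle_trans; [apply Rmax_r|apply Rmax_Cmod]. Qed.

Lemma Cmod_le_abs (z : C) : Cmod z <= Rabs (fst z) + Rabs (snd z).
Proof.
destruct z as [x y]. simpl. replace ((x, y) : C) with (((x, y) - (0%R, y)) + ((0%R, y) - (0%R, 0%R)))%C.
- eapply Rle_trans; [apply Cmod_triangle|]. rewrite Cmod_hline, Cmod_vline, !Rminus_0_r. lra.
- unfold Cminus, Cplus, Copp. simpl. f_equal; ring.
Qed.

Lemma is_derive_components_real_line (h : C -> C) t L : cdiff h (RtoC t) L ->
  is_derive (fun s => fst (h (RtoC s))) t (fst L) /\ is_derive (fun s => snd (h (RtoC s))) t (snd L).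
Proof.
intros H.
assert (K : forall (p : C -> R), (forall z, Rabs (p z) <= Cmod z) ->
  (forall z w, p (z - w)%C = p z - p w) -> (forall r z, p (z * RtoC r)%C = p z * r) ->
  is_derive (fun s => p (h (RtoC s))) t (p L)).
{ intros p P1 P2 P3. apply is_derive_Reals. intros eps He.
  destruct (H (eps / 2)) as [d [Hd H']]; [lra|]. exists (mkposreal d Hd).
  intros s Hs Hsd. simpl in Hsd.
  specialize (H' (RtoC (t + s))).
  replace (RtoC (t + s) - RtoC t)%C with (RtoC s) in H'
    by (rewrite RtoC_plus; ring).
  rewrite Cmod_R in H'. specialize (H' Hsd).
  apply (Rle_trans _ _ _ (P1 _)) in H'. rewrite !P2, P3 in H'.
  assert (0 < Rabs s) by (apply Rabs_pos_lt, Hs).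
  apply Rmult_lt_reg_r with (Rabs s); [assumption|].
  rewrite <- Rabs_mult.
  replace (((p (h (RtoC (t + s))) - p (h (RtoC t))) / s - p L) * s)
    with (p (h (RtoC (t + s))) - p (h (RtoC t)) - p L * s) by (field; exact Hs).
  eapply Rle_lt_trans; [exact H'|]. apply Rmult_lt_compat_r; lra. }
split; apply K.
- apply Cmod_fst.
- reflexivity.
- intros r z. simpl. ring.
- apply Cmod_snd.
- reflexivity.
- intros r z. simpl. ring.
Qed.

(** The real mean value theorem is applied to the real and imaginary parts separately, whence the
    factor 2. Unlike integrating f', it asks for no continuity of f', which is still to be
    proved. *)
Lemma cdiff_mean_value f fp (a b : C) K :
  (forall t, 0 <= t <= 1 -> cdiff f (a + RtoC t * (b - a))%C (fp (a + RtoC t * (b - a))%C)) ->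
  (forall t, 0 <= t <= 1 -> Cmod (fp (a + RtoC t * (b - a))%C) <= K) ->
  Cmod (f b - f a) <= 2 * K * Cmod (b - a).
Proof.
intros Hd HK.
set (h := fun z : C => f (a + z * (b - a))%C).
assert (Dh : forall t, 0 <= t <= 1 -> cdiff h (RtoC t) (fp (a + RtoC t * (b - a))%C * (b - a))%C).
{ intros t Ht. apply (cdiff_comp f (fun z => a + z * (b - a))%C).
  - apply Hd, Ht.
  - assert (E : (0 + (1 * (b - a) + RtoC t * 0) = b - a)%C) by ring.
    eapply (eq_ind _ (cdiff _ _)); [|exact E].
    apply (cdiff_plus (fun _ => a) (fun z => z * (b - a))%C); [apply cdiff_const|].
    apply (cdiff_mult (fun z => z) (fun _ => b - a)%C); [apply cdiff_id|apply cdiff_const]. }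
assert (Dl : forall t, 0 <= t <= 1 -> Cmod (fp (a + RtoC t * (b - a))%C * (b - a)) <= K * Cmod (b - a)).
{ intros t Ht. rewrite Cmod_mult. apply Rmult_le_compat_r; [apply Cmod_ge_0|apply HK, Ht]. }
assert (M : forall p : C -> R, (forall z, Rabs (p z) <= Cmod z) ->
  (forall t, 0 <= t <= 1 -> is_derive (fun s => p (h (RtoC s))) t
     (p (fp (a + RtoC t * (b - a))%C * (b - a))%C)) ->
  Rabs (p (h (RtoC 1)) - p (h (RtoC 0))) <= K * Cmod (b - a)).
{ intros p P1 P2.
  destruct (MVT_gen (fun s => p (h (RtoC s))) 0 1 (fun t => p (fp (a + RtoC t * (b - a))%C * (b - a))%C))
    as [t [Ht Et]].
  - intros t. rewrite Rmin_left, Rmax_right by lra. intros Ht. apply P2. lra.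
  - intros t. rewrite Rmin_left, Rmax_right by lra. intros Ht.
    apply continuity_pt_filterlim, (ex_derive_continuous (V := R_NormedModule)).
    eexists. apply P2, Ht.
  - rewrite Rmin_left, Rmax_right in Ht by lra. rewrite Et, Rminus_0_r, Rmult_1_r.
    eapply Rle_trans; [apply P1|apply Dl, Ht]. }
pose proof (M fst Cmod_fst (fun t Ht => proj1 (is_derive_components_real_line _ _ _ (Dh t Ht)))) as M1.
pose proof (M snd Cmod_snd (fun t Ht => proj2 (is_derive_components_real_line _ _ _ (Dh t Ht)))) as M2.
assert (E1 : h (RtoC 1) = f b) by (unfold h; f_equal; ring).
assert (E0 : h (RtoC 0) = f a) by (unfold h; f_equal; ring).
rewrite E1, E0 in M1, M2.
eapply Rle_trans; [apply Cmod_le_abs|].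
change (fst (f b - f a)%C) with (fst (f b) - fst (f a)).
change (snd (f b - f a)%C) with (snd (f b) - snd (f a)). lra.
Qed.

Lemma inv_sq_bound S x y : 0 < S -> bpt (- S) S (- S) S x y -> Cmod (/ ((x, y) * (x, y)))%C <= / S ^ 2.
Proof.
intros HS Hb. pose proof (sqbd_point_pos S x y HS Hb) as Hp.
rewrite Cmod_inv, Cmod_mult by (apply Cmult_neq_0; apply Cmod_pos_neq0; lra).
apply Rinv_le_contravar; nra.
Qed.

Lemma ccont_square_kernel f fp (w : C) S : holo f fp -> 0 < S -> Cmod w + 3 / 2 * S < 1 ->
  bcont (fun z => f (w + z)%C * / (z * z))%C (- S) S (- S) S.
Proof.
intros Hf HS Hw x y Hb.
pose proof (sqbd_point_pos S x y HS Hb) as Hp.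
apply (ccont_mult (fun z => f (w + z))%C (fun z => / (z * z))%C).
- destruct Hb as (Hx & Hy & _). apply ccont_shift.
  exact (cdiff_ccont _ _ _ (Hf _ (square_in_disc w S x y Hw Hx Hy))).
- apply (ccont_comp (fun z => / z)%C (fun z => z * z)%C).
  + apply ccont_Cinv, Cmult_neq_0; apply Cmod_pos_neq0; lra.
  + apply (ccont_mult (fun z => z) (fun z => z)); exact (cdiff_ccont _ _ _ (cdiff_id _)).
Qed.

(** Both formulas are written on the same centred square, so the kernel 1/z^2 factors out of their
    difference. The contour has length 8 S, the kernel is at most 1/S^2, and 2 PI >= 4 leaves the
    factor 2. *)
Lemma cauchy_estimate_diff f fp (w w' : C) S K : holo f fp -> 0 < S ->
  Cmod w + 3 / 2 * S < 1 -> Cmod w' + 3 / 2 * S < 1 -> 0 <= K ->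
  (forall x y, bpt (- S) S (- S) S x y -> Cmod (f (w + (x, y))%C - f (w' + (x, y))%C) <= K) ->
  Cmod (fp w - fp w') <= 2 * K / S.
Proof.
intros Hf HS Hw Hw' HK0 HK. pose proof PI2_1 as HPI.
assert (E : ((fp w - fp w') * twopii =
   sqbd (fun z => f (w + z)%C * / (z * z) - f (w' + z)%C * / (z * z)) S)%C).
{ unfold sqbd. rewrite bd_minus; try lra; try (eapply ccont_square_kernel; eassumption).
  change (bd (fun z => f (w + z) * / (z * z)) (- S) S (- S) S)%C with (sqbd (fun z => f (w + z) * / (z * z)) S)%C.
  change (bd (fun z => f (w' + z) * / (z * z)) (- S) S (- S) S)%C with (sqbd (fun z => f (w' + z) * / (z * z)) S)%C.
  rewrite (cauchy_derivative f fp w S), (cauchy_derivative f fp w' S) by assumption. ring. }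
assert (B : Cmod ((fp w - fp w') * twopii) <= 2 * (K * / S ^ 2) * ((S - - S) + (S - - S))).
{ rewrite E. unfold sqbd. apply (bd_bound _ (- S) S (- S) S (K * / S ^ 2)); try lra.
  - intros x y Hb. apply (ccont_minus (fun z => f (w + z) * / (z * z))%C (fun z => f (w' + z) * / (z * z))%C);
    refine (ccont_square_kernel _ _ _ _ Hf HS _ x y Hb); assumption.
  - intros x y Hb.
    match goal with |- Cmod (?p * ?q - ?r * _) <= _ =>
      replace (p * q - r * q)%C with ((p - r) * q)%C by ring end.
    rewrite Cmod_mult. apply Rmult_le_compat; try apply Cmod_ge_0; [apply HK, Hb|].
    apply inv_sq_bound; assumption. }
rewrite Cmod_mult, Cmod_twopii in B.
replace (2 * (K * / S ^ 2) * (S - - S + (S - - S))) with (4 * (2 * K / S)) in B by (field; lra).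
assert (0 <= 2 * K / S) by (apply Rdiv_le_0_compat; lra).
pose proof (Cmod_ge_0 (fp w - fp w')). nra.
Qed.

Lemma cauchy_estimate f fp (w : C) S : holo f fp -> (forall z, Cmod z < 1 -> Cmod (f z) < 1) ->
  0 < S -> Cmod w + 3 / 2 * S < 1 -> Cmod (fp w) <= 2 / S.
Proof.
intros Hf Hb HS Hw. pose proof PI2_1 as HPI.
assert (B : Cmod (fp w * twopii) <= 2 * (1 * / S ^ 2) * ((S - - S) + (S - - S))).
{ rewrite <- (cauchy_derivative f fp w S) by assumption. unfold sqbd. apply (bd_bound _ (- S) S (- S) S (1 * / S ^ 2)); try lra.
  - eapply ccont_square_kernel; eassumption.
  - intros x y Hxy. rewrite Cmod_mult. apply Rmult_le_compat; try apply Cmod_ge_0.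
    + destruct Hxy as (Hx & Hy & _). left. apply Hb, (square_in_disc w S); assumption.
    + apply inv_sq_bound; assumption. }
rewrite Cmod_mult, Cmod_twopii in B.
replace (2 * (1 * / S ^ 2) * (S - - S + (S - - S))) with (4 * (2 / S)) in B by (field; lra).
assert (0 <= 2 / S) by (apply Rdiv_le_0_compat; lra).
pose proof (Cmod_ge_0 (fp w)). nra.
Qed.

Lemma Cmod_segment (a b : C) t r : 0 <= t <= 1 -> Cmod a <= r -> Cmod b <= r ->
  Cmod (a + RtoC t * (b - a))%C <= r.
Proof.
intros Ht Ha Hb.
replace (a + RtoC t * (b - a))%C with (RtoC (1 - t) * a + RtoC t * b)%C
  by (rewrite RtoC_minus; ring).
eapply Rle_trans; [apply Cmod_triangle|]. rewrite !Cmod_mult, !Cmod_R, !Rabs_pos_eq by lra. nra.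
Qed.

(** Boundedness of f bounds f', so f is locally Lipschitz; the estimate for differences then passes
    the Lipschitz property on to f'. *)
Lemma holo_deriv_ccont f fp (w : C) : holo f fp -> (forall z, Cmod z < 1 -> Cmod (f z) < 1) ->
  Cmod w < 1 -> ccont fp w.
Proof.
(* Moving the centre by S and going to a corner costs at most (5/2) S, hence modulus at most 1 - 2
   S; the square of the Cauchy estimate around such a point needs another (3/2) S. *)
intros Hf Hb Hw. set (S := (1 - Cmod w) / 5). assert (HS : 0 < S) by (unfold S; lra).
assert (L : forall w' : C, Cmod (w' - w) < S -> Cmod (fp w' - fp w) <= 8 / S ^ 2 * Cmod (w' - w)).
{ intros w' Hw'. assert (Hw2 : Cmod w' < Cmod w + S) by (pose proof (Cmod_sub_le w' w); lra).
  eapply Rle_trans; [apply (cauchy_estimate_diff f fp w' w S (4 / S * Cmod (w' - w)))|].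
  - exact Hf.
  - exact HS.
  - unfold S in *. lra.
  - unfold S in *. lra.
  - apply Rmult_le_pos; [apply Rdiv_le_0_compat; lra|apply Cmod_ge_0].
  - intros x y (Hx & Hy & _). pose proof (square_point_le S x y Hx Hy) as Hq.
    assert (Hseg : forall t, 0 <= t <= 1 ->
      Cmod ((w + (x, y)) + RtoC t * ((w' + (x, y)) - (w + (x, y))))%C <= 1 - 2 * S).
    { intros t Ht. apply Cmod_segment; [exact Ht|..].
      - pose proof (Cmod_triangle w (x, y)). unfold S in *. lra.
      - pose proof (Cmod_triangle w' (x, y)). unfold S in *. lra. }
    replace (4 / S * Cmod (w' - w)) with (2 * (2 / S) * Cmod ((w' + (x, y)) - (w + (x, y)))).
    + apply (cdiff_mean_value f fp).
      * intros t Ht. apply Hf. specialize (Hseg t Ht). lra.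
      * intros t Ht. apply (cauchy_estimate f fp); try assumption. specialize (Hseg t Ht). lra.
    + replace ((w' + (x, y)) - (w + (x, y)))%C with (w' - w)%C by ring. field. lra.
  - right. field. lra. }
intros eps He. assert (H8 : 0 < 8 / S ^ 2) by (apply Rdiv_lt_0_compat; [lra|apply pow_lt; exact HS]).
exists (Rmin S (eps / (8 / S ^ 2))). split.
- apply Rmin_pos; [exact HS|]. apply Rdiv_lt_0_compat; assumption.
- intros w' Hw'.
  assert (W1 : Cmod (w' - w) < S) by (eapply Rlt_le_trans; [exact Hw'|apply Rmin_l]).
  assert (W2 : Cmod (w' - w) < eps / (8 / S ^ 2)) by (eapply Rlt_le_trans; [exact Hw'|apply Rmin_r]).
  eapply Rle_lt_trans; [apply L, W1|].
  replace eps with (8 / S ^ 2 * (eps / (8 / S ^ 2))) by (field; lra).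
  apply Rmult_lt_compat_l; assumption.
Qed.

(* [f(w + z) / z] is a primitive of [f'(w + z) / z - f(w + z) / z^2] along the contour. *)
Lemma cauchy_formula_deriv f fp (w : C) S : holo f fp ->
  (forall z, Cmod z < 1 -> Cmod (f z) < 1) -> 0 < S -> Cmod w + 3 / 2 * S < 1 ->
  sqbd (fun z => fp (w + z)%C * / z)%C S = (fp w * twopii)%C.
Proof.
intros Hf Hb HS Hw.
assert (Hn : forall x y, bpt (- S) S (- S) S x y -> ((x, y) : C) <> 0%C).
{ intros x y Hxy. apply Cmod_pos_neq0. pose proof (sqbd_point_pos S x y HS Hxy). lra. }
assert (C1 : bcont (fun z => fp (w + z)%C * / z)%C (- S) S (- S) S).
{ intros x y Hxy. apply (ccont_mult (fun z => fp (w + z)%C) (fun z => / z)%C).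
  - destruct Hxy as (Hx & Hy & _). apply ccont_shift, (holo_deriv_ccont f); try assumption.
    apply (square_in_disc w S); assumption.
  - apply ccont_Cinv, Hn, Hxy. }
assert (C2 := ccont_square_kernel f fp w S Hf HS Hw).
rewrite <- (cauchy_derivative f fp w S) by assumption.
assert (E : sqbd (fun z => fp (w + z)%C * / z - f (w + z)%C * / (z * z))%C S = 0).
{ unfold sqbd. apply (bd_prim (fun z => f (w + z)%C * / z)%C
    (fun z => fp (w + z)%C * / z - f (w + z)%C * / (z * z))%C (- S) S (- S) S); try lra.
  - intros x y Hxy.
    apply (ccont_minus (fun z => fp (w + z) * / z)%C (fun z => f (w + z) * / (z * z))%C);
      [apply C1, Hxy|apply C2, Hxy].
  - intros x y Hxy.
    match goal with |- cdiff _ _ (?p * ?q - ?r * ?s)%C =>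
      replace (p * q - r * s)%C with (p * q + r * - s)%C by ring end.
    apply (cdiff_mult (fun z => f (w + z)%C) (fun z => / z)%C).
    + destruct Hxy as (Hx & Hy & _). apply cdiff_shift, Hf, (square_in_disc w S); assumption.
    + apply cdiff_Cinv, Hn, Hxy. }
unfold sqbd in *. rewrite bd_minus in E; try lra; try assumption.
match type of E with (?p - ?q)%C = _ => replace p with ((p - q) + q)%C by ring end.
rewrite E. ring.
Qed.

(** * Iterated integrals of continuous functions and the sub-mean-value inequality *)

(** Continuity on the whole plane gives existence of all section and iterated integrals without
    domain conditions. *)
Definition cont2 (p : R -> R -> R) : Prop := forall x y, continuity_2d_pt p x y.

Lemma continuous_eps (f : R -> R) x :
  (forall eps, 0 < eps -> exists delta, 0 < delta /\
     forall y, Rabs (y - x) < delta -> Rabs (f y - f x) < eps) -> continuous f x.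
Proof.
intros H. apply filterlim_locally. intros eps. destruct (H eps (cond_pos eps)) as [d [Hd H']].
exists (mkposreal d Hd). intros y Hy. apply H', Hy.
Qed.

Lemma continuous_eps_inv (f : R -> R) x : continuous f x ->
  forall eps, 0 < eps -> exists delta, 0 < delta /\
     forall y, Rabs (y - x) < delta -> Rabs (f y - f x) < eps.
Proof.
intros H eps He. apply (proj1 (filterlim_locally _ _)) with (eps := mkposreal eps He) in H.
destruct H as [d H]. exists d. split; [apply cond_pos|]. intros y Hy. apply (H y Hy).
Qed.

Lemma cont2_transpose p : cont2 p -> cont2 (fun y x => p x y).
Proof.
intros H y x eps. destruct (H x y eps) as [d Hd]. exists d. intros u v Hu Hv. apply Hd; assumption.
Qed.

Lemma cont2_section p x y : cont2 p -> continuous (p x) y.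
Proof.
intros H. apply continuous_eps. intros eps He. destruct (H x y (mkposreal eps He)) as [d Hd].
exists d. split; [apply cond_pos|]. intros v Hv. apply Hd; [|exact Hv].
rewrite Rminus_eq_0, Rabs_R0. apply cond_pos.
Qed.

Lemma cont2_ex_RInt p x a b : cont2 p -> ex_RInt (p x) a b.
Proof. intros H. apply (ex_RInt_continuous (V := R_CompleteNormedModule)). intros y _. apply cont2_section, H. Qed.

Lemma ex_RInt_cont (f : R -> R) a b : (forall x, continuous f x) -> ex_RInt f a b.
Proof. intros H. apply (ex_RInt_continuous (V := R_CompleteNormedModule)). intros y _. apply H. Qed.

Lemma abs_RInt_bound (f : R -> R) a b M : (forall x, continuous f x) ->
  (forall t, Rmin a b <= t <= Rmax a b -> Rabs (f t) <= M) ->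
  Rabs (RInt f a b) <= Rabs (b - a) * M.
Proof.
intros Hf HM. apply (norm_RInt_le_const_abs (V := R_NormedModule) f a b).
- exact HM.
- apply (RInt_correct f), ex_RInt_cont, Hf.
Qed.

(** The increment splits into a change of integrand on a fixed interval, controlled by uniform
    continuity, and the integral over the short interval from [beta x0] to [beta x], where the
    integrand is bounded by M. The moving limit is meant for chords of a disc. *)
Lemma continuous_RInt_param p (beta : R -> R) c : cont2 p -> (forall x, continuous beta x) ->
  forall x, continuous (fun x => RInt (p x) c (beta x)) x.
Proof.
intros Hp Hb x0. apply continuous_eps. intros eps He.
set (b0 := beta x0).
assert (P1 : 0 < eps / (2 * (Rabs (b0 - c) + 1))).
{ apply Rdiv_lt_0_compat; [exact He|]. pose proof (Rabs_pos (b0 - c)). lra. }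
destruct (uniform_continuity_2d_1d' p (Rmin c b0) (Rmax c b0) x0 ltac:(intros; apply Hp) (mkposreal _ P1))
  as [d1 H1]. simpl in H1.
destruct (Hp x0 b0 (mkposreal 1 Rlt_0_1)) as [d2 H2]. simpl in H2.
set (M := Rabs (p x0 b0) + 1). assert (HM : 0 < M) by (unfold M; pose proof (Rabs_pos (p x0 b0)); lra).
destruct (continuous_eps_inv beta x0 (Hb x0) (Rmin d2 (eps / (2 * M)))) as [d3 [Hd3 H3]].
{ apply Rmin_pos; [apply cond_pos|]. apply Rdiv_lt_0_compat; lra. }
exists (Rmin d1 (Rmin d2 d3)). split.
{ repeat apply Rmin_pos; try apply cond_pos; assumption. }
intros x Hx.
assert (W1 : Rabs (x - x0) < d1) by (eapply Rlt_le_trans; [exact Hx|apply Rmin_l]).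
assert (W23 : Rabs (x - x0) < Rmin d2 d3) by (eapply Rlt_le_trans; [exact Hx|apply Rmin_r]).
assert (W2 : Rabs (x - x0) < d2) by (eapply Rlt_le_trans; [exact W23|apply Rmin_l]).
assert (W3 : Rabs (x - x0) < d3) by (eapply Rlt_le_trans; [exact W23|apply Rmin_r]).
specialize (H3 x W3). fold b0 in H3.
assert (V1 : Rabs (beta x - b0) < d2) by (eapply Rlt_le_trans; [exact H3|apply Rmin_l]).
assert (V2 : Rabs (beta x - b0) < eps / (2 * M)) by (eapply Rlt_le_trans; [exact H3|apply Rmin_r]).
assert (Hc : forall x y, continuous (p x) y) by (intros; apply cont2_section, Hp).
replace (RInt (p x) c (beta x) - RInt (p x0) c b0) with
  (RInt (fun y => p x y - p x0 y) c b0 + RInt (p x) b0 (beta x)).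
2: { rewrite <- (RInt_Chasles (V := R_CompleteNormedModule) (p x) c b0 (beta x)) by (apply ex_RInt_cont, Hc).
     rewrite (RInt_minus (V := R_CompleteNormedModule) (p x) (p x0)) by (apply ex_RInt_cont, Hc).
     unfold minus, plus, opp. simpl. ring. }
eapply Rle_lt_trans; [apply Rabs_triang|].
assert (B1 : Rabs (RInt (fun y => p x y - p x0 y) c b0) <= Rabs (b0 - c) * (eps / (2 * (Rabs (b0 - c) + 1)))).
{ apply abs_RInt_bound.
  - intros y. apply (continuous_minus (V := R_NormedModule) (p x) (p x0)); apply Hc.
  - intros t Ht. left. apply H1; try assumption.
    + pose proof (cond_pos d1). lra.
    + apply Rabs_def2 in W1. lra.
    + rewrite Rminus_eq_0, Rabs_R0. apply cond_pos. }
assert (B2 : Rabs (RInt (p x) b0 (beta x)) <= Rabs (beta x - b0) * M).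
{ apply abs_RInt_bound; [apply Hc|]. intros t Ht.
  assert (T : Rabs (t - b0) < d2).
  { eapply Rle_lt_trans; [|exact V1]. revert Ht. unfold Rmin, Rmax, Rabs.
    repeat (destruct Rle_dec || destruct Rcase_abs); lra. }
  specialize (H2 x t W2 T). unfold M.
  replace (p x t) with (p x0 b0 + (p x t - p x0 b0)) by ring.
  eapply Rle_trans; [apply Rabs_triang|]. lra. }
assert (B3 : Rabs (b0 - c) * (eps / (2 * (Rabs (b0 - c) + 1))) < eps / 2).
{ pose proof (Rabs_pos (b0 - c)).
  replace (eps / 2) with ((Rabs (b0 - c) + 1) * (eps / (2 * (Rabs (b0 - c) + 1)))) by (field; lra).
  apply Rmult_lt_compat_r; lra. }
assert (B4 : Rabs (beta x - b0) * M <= eps / 2).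
{ replace (eps / 2) with (eps / (2 * M) * M) by (field; lra). apply Rmult_le_compat_r; lra. }
lra.
Qed.

Lemma continuous_RInt_section p a b x : cont2 p -> continuous (fun x => RInt (p x) a b) x.
Proof.
intros Hp. apply (continuous_RInt_param p (fun _ => b) a Hp). intros y. apply continuous_const.
Qed.

Definition rint (p : R -> R -> R) a b c d := RInt (fun x => RInt (p x) c d) a b.

(** As functions of the right end u of the x-interval, both iterated integrals vanish at u = a and
    have the same derivative, the integral of [p u] over the y-interval. *)
Lemma fubini p a b c d : cont2 p -> a <= b ->
  rint p a b c d = rint (fun y x => p x y) c d a b.
Proof.
intros Hp Hab. assert (Hp' := cont2_transpose p Hp).
set (F := fun u => rint p a u c d - rint (fun y x => p x y) c d a u).
assert (D : forall u, is_derive F u 0).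
{ intros u. unfold F, rint.
  replace 0 with (minus (RInt (p u) c d) (RInt (fun t => Derive (fun z => RInt (fun x => p x t) a z) u) c d)).
  - apply (is_derive_minus (V := R_NormedModule)).
    + apply (is_derive_RInt (V := R_NormedModule) (fun x => RInt (p x) c d) _ a u).
      * exists (mkposreal 1 Rlt_0_1). intros y _. apply (RInt_correct (V := R_CompleteNormedModule)).
        apply ex_RInt_cont. intros x. apply continuous_RInt_section, Hp.
      * apply continuous_RInt_section, Hp.
    + apply (is_derive_RInt_param (fun u t => RInt (fun x => p x t) a u)).
      * exists (mkposreal 1 Rlt_0_1). intros y _ t _. exists (p y t).
        apply (is_derive_RInt (V := R_NormedModule) (fun x => p x t) _ a y).
        -- exists (mkposreal 1 Rlt_0_1). intros z _. apply (RInt_correct (V := R_CompleteNormedModule)).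
           apply (cont2_ex_RInt (fun y x => p x y) t), Hp'.
        -- apply (cont2_section (fun y x => p x y) t), Hp'.
      * intros t _. apply (continuity_2d_pt_ext p); [|apply Hp].
        intros x y. symmetry. apply is_derive_unique.
        apply (is_derive_RInt (V := R_NormedModule) (fun x => p x y) _ a x).
        -- exists (mkposreal 1 Rlt_0_1). intros z _. apply (RInt_correct (V := R_CompleteNormedModule)).
           apply (cont2_ex_RInt (fun y x => p x y) y), Hp'.
        -- apply (cont2_section (fun y x => p x y) y), Hp'.
      * exists (mkposreal 1 Rlt_0_1). intros y _. apply ex_RInt_cont. intros t.
        apply (continuous_RInt_section (fun y x => p x y)), Hp'.
  - assert (E : RInt (fun t => Derive (fun z => RInt (fun x => p x t) a z) u) c d = RInt (p u) c d).
    { apply RInt_ext. intros t _. apply is_derive_unique.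
      apply (is_derive_RInt (V := R_NormedModule) (fun x => p x t) _ a u).
      -- exists (mkposreal 1 Rlt_0_1). intros z _. apply (RInt_correct (V := R_CompleteNormedModule)).
         apply (cont2_ex_RInt (fun y x => p x y) t), Hp'.
      -- apply (cont2_section (fun y x => p x y) t), Hp'. }
    rewrite E. apply Rminus_diag_eq. reflexivity. }
destruct (Rle_lt_or_eq_dec a b Hab) as [Hlt|E].
- assert (E := eq_is_derive (V := R_NormedModule) F a b (fun t _ => D t) Hlt).
  assert (E0 : F a = 0).
  { unfold F, rint. rewrite (RInt_point (V := R_CompleteNormedModule) a).
    rewrite (RInt_ext (V := R_CompleteNormedModule) _ (fun _ => 0)).
    - rewrite (RInt_const (V := R_CompleteNormedModule)). unfold zero, scal. simpl. unfold mult. simpl. ring.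
    - intros y _. apply (RInt_point (V := R_CompleteNormedModule) a). }
  rewrite E0 in E. unfold F in E. lra.
- subst b. unfold rint. rewrite (RInt_point (V := R_CompleteNormedModule) a).
  rewrite (RInt_ext (V := R_CompleteNormedModule) _ (fun _ => 0)).
  + rewrite (RInt_const (V := R_CompleteNormedModule)). unfold zero, scal. simpl. unfold mult. simpl. ring.
  + intros y _. apply (RInt_point (V := R_CompleteNormedModule) a).
Qed.

Lemma RInt_incl (f : R -> R) a' a b b' : (forall x, continuous f x) -> (forall x, 0 <= f x) ->
  a' <= a -> a <= b -> b <= b' -> RInt f a b <= RInt f a' b'.
Proof.
intros Hc Hf H1 H2 H3.
rewrite <- (RInt_Chasles (V := R_CompleteNormedModule) f a' a b') by (apply ex_RInt_cont, Hc).
rewrite <- (RInt_Chasles (V := R_CompleteNormedModule) f a b b') by (apply ex_RInt_cont, Hc).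
assert (0 <= RInt f a' a) by (apply RInt_ge_0; [assumption|apply ex_RInt_cont, Hc|intros; apply Hf]).
assert (0 <= RInt f b b') by (apply RInt_ge_0; [assumption|apply ex_RInt_cont, Hc|intros; apply Hf]).
unfold plus. simpl. lra.
Qed.

Lemma RInt_shift_right (f : R -> R) v s : (forall x, continuous f x) ->
  RInt (fun t => f (v + t)) 0 s = RInt f v (v + s).
Proof.
intros Hc. rewrite <- (RInt_ext (V := R_CompleteNormedModule) (fun y => scal 1 (f (1 * y + v)))).
- rewrite (RInt_comp_lin (V := R_CompleteNormedModule)) by (apply ex_RInt_cont, Hc). f_equal; ring.
- intros x _. unfold scal. simpl. unfold mult. simpl. rewrite !Rmult_1_l. f_equal. ring.
Qed.

Lemma RInt_shift_left (f : R -> R) v s : (forall x, continuous f x) ->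
  RInt (fun t => f (v - t)) 0 s = RInt f (v - s) v.
Proof.
intros Hc.
rewrite <- (opp_RInt_swap (V := R_CompleteNormedModule) f v) by (apply ex_RInt_cont, Hc).
replace (RInt f v (v - s)) with (RInt f (-1 * 0 + v) (-1 * s + v)) by (f_equal; ring).
rewrite <- (RInt_comp_lin (V := R_CompleteNormedModule)) by (apply ex_RInt_cont, Hc).
rewrite <- (RInt_opp (V := R_CompleteNormedModule)).
- apply RInt_ext. intros x _. unfold scal, opp. simpl. unfold mult. simpl.
  replace (-1 * x + v) with (v - x) by ring. ring.
- apply ex_RInt_cont. intros x. apply (continuous_scal_r (V := R_NormedModule)).
  apply (continuous_comp (fun y => -1 * y + v) f); [|apply Hc].
  apply (ex_derive_continuous (V := R_NormedModule)). auto_derive. exact I.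
Qed.

(** The arc-length integral of [P] over the boundary of a square centred at (x0, y0). *)
Definition side_sum (P : R -> R -> R) x0 y0 s :=
  RInt (fun x => P x (y0 - s)) (x0 - s) (x0 + s) + RInt (P (x0 + s)) (y0 - s) (y0 + s)
  + RInt (fun x => P x (y0 + s)) (x0 - s) (x0 + s) + RInt (P (x0 - s)) (y0 - s) (y0 + s).

Lemma submean_square P x0 y0 s : cont2 P -> (forall x y, 0 <= P x y) -> 0 < s ->
  (forall t, 0 < t < s -> 2 * PI * t * P x0 y0 <= side_sum P x0 y0 t) ->
  PI * s ^ 2 * P x0 y0 <= 2 * rint P (x0 - s) (x0 + s) (y0 - s) (y0 + s).
Proof.
intros Hc HP Hs H. assert (Hc' := cont2_transpose P Hc).
set (V := fun x => RInt (P x) (y0 - s) (y0 + s)).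
set (W := fun y => RInt (fun x => P x y) (x0 - s) (x0 + s)).
assert (CV : forall x, continuous V x) by (intros x; apply continuous_RInt_section, Hc).
assert (CW : forall x, continuous W x) by (intros x; apply (continuous_RInt_section (fun y x => P x y)), Hc').
assert (L1 : forall v x, continuous (fun t => v + t) x).
{ intros v x. apply (ex_derive_continuous (V := R_NormedModule)). auto_derive. exact I. }
assert (L2 : forall v x, continuous (fun t => v - t) x).
{ intros v x. apply (ex_derive_continuous (V := R_NormedModule)). auto_derive. exact I. }
assert (CV1 : forall x, continuous (fun t => V (x0 + t)) x) by (intros x; apply (continuous_comp (fun t => x0 + t) V); [apply L1|apply CV]).
assert (CV2 : forall x, continuous (fun t => V (x0 - t)) x) by (intros x; apply (continuous_comp (fun t => x0 - t) V); [apply L2|apply CV]).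
assert (CW1 : forall x, continuous (fun t => W (y0 + t)) x) by (intros x; apply (continuous_comp (fun t => y0 + t) W); [apply L1|apply CW]).
assert (CW2 : forall x, continuous (fun t => W (y0 - t)) x) by (intros x; apply (continuous_comp (fun t => y0 - t) W); [apply L2|apply CW]).
assert (I1 : is_RInt (fun t => 2 * PI * t * P x0 y0) 0 s (PI * s ^ 2 * P x0 y0)).
{ replace (PI * s ^ 2 * P x0 y0) with (minus (PI * s ^ 2 * P x0 y0) (PI * 0 ^ 2 * P x0 y0))
    by (unfold minus, plus, opp; simpl; ring).
  apply (is_RInt_derive (V := R_CompleteNormedModule) (fun t => PI * t ^ 2 * P x0 y0)).
  - intros t _. auto_derive; [exact I|]. ring.
  - intros t _. apply (ex_derive_continuous (V := R_NormedModule)). auto_derive. exact I. }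
assert (I2 : is_RInt (fun t => (W (y0 - t) + V (x0 + t)) + (W (y0 + t) + V (x0 - t))) 0 s
  ((RInt W (y0 - s) y0 + RInt V x0 (x0 + s)) + (RInt W y0 (y0 + s) + RInt V (x0 - s) x0))).
{ rewrite <- (RInt_shift_left W), <- (RInt_shift_left V), <- (RInt_shift_right W), <- (RInt_shift_right V) by assumption.
  apply (is_RInt_plus (V := R_NormedModule)); apply (is_RInt_plus (V := R_NormedModule));
  apply (RInt_correct (V := R_CompleteNormedModule)), ex_RInt_cont; assumption. }
assert (K : PI * s ^ 2 * P x0 y0 <=
  (RInt W (y0 - s) y0 + RInt V x0 (x0 + s)) + (RInt W y0 (y0 + s) + RInt V (x0 - s) x0)).
{ refine (is_RInt_le _ _ 0 s _ _ _ I1 I2 _); [lra|]. intros t Ht.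
  eapply Rle_trans; [apply H, Ht|]. unfold side_sum.
  (* Each side is lengthened to a full chord of the large square. As t runs, the horizontal chords
     sweep the square once and the vertical ones once more: hence the factor 2 in the conclusion. *)
  assert (A1 : forall y, RInt (fun x => P x y) (x0 - t) (x0 + t) <= W y).
  { intros y. apply RInt_incl; try lra; [|intros; apply HP].
    intros x. apply (cont2_section (fun y x => P x y) y), Hc'. }
  assert (A2 : forall x, RInt (P x) (y0 - t) (y0 + t) <= V x).
  { intros x. apply RInt_incl; try lra; [|intros; apply HP]. intros y. apply cont2_section, Hc. }
  pose proof (A1 (y0 - t)). pose proof (A1 (y0 + t)). pose proof (A2 (x0 - t)). pose proof (A2 (x0 + t)).
  lra. }
assert (E1 : RInt W (y0 - s) y0 + RInt W y0 (y0 + s) = rint P (x0 - s) (x0 + s) (y0 - s) (y0 + s)).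
{ rewrite fubini by (try assumption; lra).
  apply (RInt_Chasles (V := R_CompleteNormedModule) W); apply ex_RInt_cont, CW. }
assert (E2 : RInt V (x0 - s) x0 + RInt V x0 (x0 + s) = rint P (x0 - s) (x0 + s) (y0 - s) (y0 + s)).
{ apply (RInt_Chasles (V := R_CompleteNormedModule) V); apply ex_RInt_cont, CV. }
lra.
Qed.

Lemma rint_le p q a b c d : cont2 p -> cont2 q -> a <= b -> c <= d ->
  (forall x y, p x y <= q x y) -> rint p a b c d <= rint q a b c d.
Proof.
intros Hp Hq Hab Hcd H. apply RInt_le; try assumption;
try (apply ex_RInt_cont; intros x; apply continuous_RInt_section; assumption).
intros x _. apply RInt_le; try assumption; try (apply cont2_ex_RInt; assumption). intros y _. apply H.
Qed.

Lemma cont2_cst (k : R) : cont2 (fun _ _ => k).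
Proof. intros x y. apply continuity_2d_pt_const. Qed.

Lemma cont2_plus p q : cont2 p -> cont2 q -> cont2 (fun x y => p x y + q x y).
Proof. intros Hp Hq x y. apply continuity_2d_pt_plus; [apply Hp|apply Hq]. Qed.

Lemma cont2_mult p q : cont2 p -> cont2 q -> cont2 (fun x y => p x y * q x y).
Proof. intros Hp Hq x y. apply continuity_2d_pt_mult; [apply Hp|apply Hq]. Qed.

Lemma rint_plus_cst p k a b c d : cont2 p ->
  rint (fun x y => k + p x y) a b c d = k * (d - c) * (b - a) + rint p a b c d.
Proof.
intros Hp. unfold rint.
rewrite (RInt_ext (V := R_CompleteNormedModule) _ (fun x => plus (k * (d - c)) (RInt (p x) c d))).
- rewrite (RInt_plus (V := R_CompleteNormedModule)).
  + rewrite (RInt_const (V := R_CompleteNormedModule)).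
    unfold plus, scal. simpl. unfold mult. simpl. ring.
  + apply ex_RInt_const.
  + apply ex_RInt_cont. intros x. apply continuous_RInt_section, Hp.
- intros x _. rewrite (RInt_plus (V := R_CompleteNormedModule) (fun _ => k) (p x)).
  + rewrite (RInt_const (V := R_CompleteNormedModule)).
    unfold plus, scal. simpl. unfold mult. simpl. ring.
  + apply ex_RInt_const.
  + apply cont2_ex_RInt, Hp.
Qed.

Lemma rint_scal p k a b c d : cont2 p ->
  rint (fun x y => k * p x y) a b c d = k * rint p a b c d.
Proof.
intros Hp. unfold rint.
rewrite (RInt_ext (V := R_CompleteNormedModule) _ (fun x => scal k (RInt (p x) c d))).
- apply (RInt_scal (V := R_CompleteNormedModule)). apply ex_RInt_cont. intros x. apply continuous_RInt_section, Hp.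
- intros x _. apply (RInt_scal (V := R_CompleteNormedModule)). apply cont2_ex_RInt, Hp.
Qed.

(** Instead of Cauchy-Schwarz, P0 P <= P0^2 / 4 + P^2 is integrated over the square, of area 4 s^2.
    The constant term then costs 2 s^2 P0^2, and PI >= 3 leaves one copy of s^2 P0^2. *)
Lemma submean_square_sq P x0 y0 s : cont2 P -> (forall x y, 0 <= P x y) -> 0 < s ->
  (forall t, 0 < t < s -> 2 * PI * t * P x0 y0 <= side_sum P x0 y0 t) ->
  s ^ 2 * P x0 y0 ^ 2 <= 2 * rint (fun x y => P x y ^ 2) (x0 - s) (x0 + s) (y0 - s) (y0 + s).
Proof.
intros Hc HP Hs H. pose proof (submean_square P x0 y0 s Hc HP Hs H) as M.
assert (Hc2 : cont2 (fun x y => P x y ^ 2)).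
{ apply (cont2_mult P (fun x y => P x y * 1)); [exact Hc|].
  apply (cont2_mult P); [exact Hc|apply cont2_cst]. }
set (P0 := P x0 y0) in *. assert (HP0 : 0 <= P0) by apply HP.
assert (L : P0 * rint P (x0 - s) (x0 + s) (y0 - s) (y0 + s) <=
  P0 ^ 2 / 4 * (y0 + s - (y0 - s)) * (x0 + s - (x0 - s)) +
  rint (fun x y => P x y ^ 2) (x0 - s) (x0 + s) (y0 - s) (y0 + s)).
{ rewrite <- rint_scal, <- rint_plus_cst by assumption. apply rint_le; try lra.
  - apply (cont2_mult (fun _ _ => P0)); [apply cont2_cst|exact Hc].
  - apply (cont2_plus (fun _ _ => P0 ^ 2 / 4)); [apply cont2_cst|exact Hc2].
  - intros x y. pose proof (pow2_ge_0 (P0 / 2 - P x y)). nra. }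
pose proof PI2_3_2 as HPI.
assert (0 <= s ^ 2 * P0 ^ 2) by (apply Rmult_le_pos; apply pow2_ge_0).
assert (K : PI * s ^ 2 * P0 * P0 <= 2 * rint P (x0 - s) (x0 + s) (y0 - s) (y0 + s) * P0)
  by (apply Rmult_le_compat_r; assumption).
assert (3 * (s ^ 2 * P0 ^ 2) <= PI * (s ^ 2 * P0 ^ 2)) by (apply Rmult_le_compat_r; lra).
nra.
Qed.

(** * Areas of discs and annuli *)

(** The shape is dictated by the iterated integrals in [hyp_area_finite]. *)
Definition slice (p : R -> R -> R) r x := RInt (p x) (- sqrt (r ^ 2 - x ^ 2)) (sqrt (r ^ 2 - x ^ 2)).
Definition disc_int (p : R -> R -> R) r := RInt (slice p r) (- r) r.

Lemma continuous_half_chord r x : continuous (fun x => sqrt (r ^ 2 - x ^ 2)) x.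
Proof.
apply (continuous_comp (fun x => r ^ 2 - x ^ 2) sqrt).
- apply (ex_derive_continuous (V := R_NormedModule)). auto_derive. exact I.
- apply continuous_sqrt.
Qed.

Lemma continuous_slice p r x : cont2 p -> continuous (slice p r) x.
Proof.
intros Hp.
apply (continuous_ext (fun x => minus (RInt (p x) 0 (sqrt (r ^ 2 - x ^ 2))) (RInt (p x) 0 (- sqrt (r ^ 2 - x ^ 2))))).
- intros t. unfold slice.
  rewrite <- (RInt_Chasles (V := R_CompleteNormedModule) (p t) (- sqrt (r ^ 2 - t ^ 2)) 0) by (apply cont2_ex_RInt, Hp).
  rewrite <- (opp_RInt_swap (V := R_CompleteNormedModule) (p t) (- sqrt (r ^ 2 - t ^ 2)) 0) by (apply cont2_ex_RInt, Hp).
  unfold minus, plus, opp. simpl. ring.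
- apply (continuous_minus (V := R_NormedModule)).
  + apply (continuous_RInt_param p (fun x => sqrt (r ^ 2 - x ^ 2)) 0 Hp). apply continuous_half_chord.
  + apply (continuous_RInt_param p (fun x => - sqrt (r ^ 2 - x ^ 2)) 0 Hp). intros y.
    apply (continuous_opp (V := R_NormedModule) (fun x => sqrt (r ^ 2 - x ^ 2))), continuous_half_chord.
Qed.

(** Beyond the disc [sqrt] takes its default value 0, so the chord degenerates to a point. *)
Lemma slice_outside p r x : r ^ 2 <= x ^ 2 -> slice p r x = 0.
Proof.
intros H. unfold slice. rewrite sqrt_neg_0 by lra. rewrite Ropp_0.
apply (RInt_point (V := R_CompleteNormedModule)).
Qed.

Lemma RInt_split (f : R -> R) a b c : (forall x, continuous f x) ->
  RInt f a c = RInt f a b + RInt f b c.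
Proof.
intros Hc. symmetry. apply (RInt_Chasles (V := R_CompleteNormedModule)); apply ex_RInt_cont, Hc.
Qed.

(** Brings concentric discs to a common outer interval, so that their integrals can be subtracted
    slice by slice. *)
Lemma disc_int_widen p r s : cont2 p -> 0 <= r <= s -> disc_int p r = RInt (slice p r) (- s) s.
Proof.
intros Hp Hr. unfold disc_int.
assert (Hc : forall x, continuous (slice p r) x) by (intros; apply continuous_slice, Hp).
rewrite (RInt_split (slice p r) (- s) (- r) s), (RInt_split (slice p r) (- r) r s) by exact Hc.
assert (Z : forall u v, u <= v -> (forall x, u < x < v -> r ^ 2 <= x ^ 2) -> RInt (slice p r) u v = 0).
{ intros u v Huv H. rewrite (RInt_ext (V := R_CompleteNormedModule) _ (fun _ => 0)).
  - rewrite (RInt_const (V := R_CompleteNormedModule)). unfold scal. simpl. unfold mult. simpl. ring.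
  - intros x. rewrite Rmin_left, Rmax_right by assumption. intros Hx. apply slice_outside, H, Hx. }
assert (Z1 : RInt (slice p r) (- s) (- r) = 0) by (apply Z; [lra|intros x Hx; nra]).
assert (Z2 : RInt (slice p r) r s = 0) by (apply Z; [lra|intros x Hx; nra]).
lra.
Qed.

(* A vertical segment contained in an annulus lies in one of the two components of the
   corresponding chord of the annulus. *)
Lemma slice_annulus p r1 r2 x c d : cont2 p -> (forall x y, 0 <= p x y) -> 0 <= r1 <= r2 -> c <= d ->
  (forall y, c <= y <= d -> r1 ^ 2 <= x ^ 2 + y ^ 2 <= r2 ^ 2) ->
  RInt (p x) c d <= slice p r2 x - slice p r1 x.
Proof.
intros Hp Hpos Hr Hcd H. unfold slice.
set (b1 := sqrt (r1 ^ 2 - x ^ 2)). set (b2 := sqrt (r2 ^ 2 - x ^ 2)).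
assert (B1 : 0 <= b1) by apply sqrt_pos.
assert (B2 : b1 <= b2) by (apply sqrt_le_1_alt; nra).
assert (Hc : forall y, continuous (p x) y) by (intros; apply cont2_section, Hp).
assert (E : RInt (p x) (- b2) b2 - RInt (p x) (- b1) b1 = RInt (p x) (- b2) (- b1) + RInt (p x) b1 b2).
{ rewrite (RInt_split (p x) (- b2) (- b1) b2), (RInt_split (p x) (- b1) b1 b2) by exact Hc.
  ring. }
rewrite E.
assert (N1 : 0 <= RInt (p x) (- b2) (- b1)) by (apply RInt_ge_0; [lra|apply ex_RInt_cont, Hc|intros; apply Hpos]).
assert (N2 : 0 <= RInt (p x) b1 b2) by (apply RInt_ge_0; [lra|apply ex_RInt_cont, Hc|intros; apply Hpos]).
assert (U : forall y, c <= y <= d -> Rabs y <= b2).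
{ intros y Hy. unfold b2. rewrite <- sqrt_Rsqr_abs. apply sqrt_le_1_alt. unfold Rsqr. specialize (H y Hy). nra. }
assert (L : forall y, c <= y <= d -> b1 <= Rabs y).
{ intros y Hy. unfold b1. rewrite <- sqrt_Rsqr_abs. apply sqrt_le_1_alt. unfold Rsqr. specialize (H y Hy). nra. }
assert (Uc := U c ltac:(lra)). assert (Ud := U d ltac:(lra)).
assert (Lc := L c ltac:(lra)). assert (Ld := L d ltac:(lra)).
apply Rabs_le_between in Uc, Ud.
destruct (Rle_dec 0 c) as [C0|C0]; [|destruct (Rle_dec d 0) as [D0|D0]].
- rewrite Rabs_pos_eq in Lc by lra.
  pose proof (RInt_incl (p x) b1 c d b2 Hc (Hpos x)). lra.
- rewrite Rabs_left1 in Ld by lra.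
  pose proof (RInt_incl (p x) (- b2) c d (- b1) Hc (Hpos x)). lra.
(* The segment crosses the real axis, so the point of height 0 lies in the annulus and the inner
   half-chord is 0. *)
- specialize (L 0 ltac:(lra)). rewrite Rabs_R0 in L.
  assert (Eb : b1 = 0) by lra. rewrite Eb, Ropp_0 in *.
  rewrite <- (RInt_split (p x) (- b2) 0 b2) by exact Hc. apply RInt_incl; try assumption; try lra. apply Hpos.
Qed.

Lemma slice_mono p r1 r2 x : cont2 p -> (forall x y, 0 <= p x y) -> 0 <= r1 <= r2 ->
  slice p r1 x <= slice p r2 x.
Proof.
intros Hp Hpos Hr. unfold slice.
assert (sqrt (r1 ^ 2 - x ^ 2) <= sqrt (r2 ^ 2 - x ^ 2)) by (apply sqrt_le_1_alt; nra).
pose proof (sqrt_pos (r1 ^ 2 - x ^ 2)).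
apply RInt_incl; try lra; [intros; apply cont2_section, Hp|apply Hpos].
Qed.

Lemma rint_annulus p r1 r2 a b c d : cont2 p -> (forall x y, 0 <= p x y) -> 0 <= r1 <= r2 ->
  a <= b -> c <= d ->
  (forall x y, a <= x <= b -> c <= y <= d -> r1 ^ 2 <= x ^ 2 + y ^ 2 <= r2 ^ 2) ->
  rint p a b c d <= disc_int p r2 - disc_int p r1.
Proof.
intros Hp Hpos Hr Hab Hcd H.
rewrite (disc_int_widen p r1 r2) by assumption. unfold disc_int.
assert (Hc : forall r x, continuous (slice p r) x) by (intros; apply continuous_slice, Hp).
assert (Em : RInt (slice p r2) (- r2) r2 - RInt (slice p r1) (- r2) r2 =
  RInt (fun x => minus (slice p r2 x) (slice p r1 x)) (- r2) r2).
{ symmetry. apply (RInt_minus (V := R_CompleteNormedModule)); apply ex_RInt_cont, Hc. }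
rewrite Em.
assert (Hb : forall x, a <= x <= b -> - r2 <= x <= r2).
{ intros x Hx. specialize (H x c Hx ltac:(lra)). split; nra. }
assert (Ha := Hb a ltac:(lra)). specialize (Hb b ltac:(lra)).
assert (Hd : forall x, continuous (fun x => minus (slice p r2 x) (slice p r1 x)) x).
{ intros x. apply (continuous_minus (V := R_NormedModule)); apply Hc. }
eapply Rle_trans; [|apply (RInt_incl _ _ a b); try lra; [exact Hd|]].
- apply RInt_le; try assumption.
  + apply ex_RInt_cont. intros x. apply continuous_RInt_section, Hp.
  + apply ex_RInt_cont, Hd.
  + intros x Hx. apply slice_annulus; try assumption. intros y Hy. apply H; lra.
- intros x. pose proof (slice_mono p r1 r2 x Hp Hpos Hr).
  change (0 <= slice p r2 x - slice p r1 x). lra.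
Qed.

Lemma disc_int_ext p q r : 0 <= r -> (forall x y, x ^ 2 + y ^ 2 <= r ^ 2 -> p x y = q x y) ->
  disc_int p r = disc_int q r.
Proof.
intros Hr H. unfold disc_int. apply RInt_ext. intros x.
rewrite Rmin_left, Rmax_right by lra. intros Hx.
unfold slice. apply RInt_ext. intros y.
pose proof (sqrt_pos (r ^ 2 - x ^ 2)). rewrite Rmin_left, Rmax_right by lra. intros Hy. apply H.
assert (0 <= r ^ 2 - x ^ 2) by nra. pose proof (sqrt_sqrt _ H1). nra.
Qed.

(* Radial retraction of the plane onto the disc of radius [r]: it lets us replace a function
   defined on the disc by one continuous on the whole plane. *)
Definition ret (r : R) (z : C) : C := (RtoC (r / Rmax r (Cmod z)) * z)%C.

Lemma ret_id r z : 0 < r -> Cmod z <= r -> ret r z = z.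
Proof.
intros Hr Hz. unfold ret. rewrite Rmax_left by exact Hz. rewrite Rdiv_diag by lra. ring.
Qed.

Lemma Cmod_ret r z : 0 < r -> Cmod (ret r z) <= r.
Proof.
intros Hr. unfold ret. pose proof (Rmax_l r (Cmod z)). pose proof (Rmax_r r (Cmod z)).
assert (0 < / Rmax r (Cmod z)) by (apply Rinv_0_lt_compat; lra).
rewrite Cmod_mult, Cmod_R, Rabs_pos_eq by (apply Rdiv_le_0_compat; lra).
apply Rmult_le_reg_r with (Rmax r (Cmod z)); [lra|].
replace (r / Rmax r (Cmod z) * Cmod z * Rmax r (Cmod z)) with (r * Cmod z) by (field; lra).
apply Rmult_le_compat_l; lra.
Qed.

Lemma Cmod_lip (z w : C) : Rabs (Cmod w - Cmod z) <= Cmod (w - z).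
Proof.
apply Rabs_le. pose proof (Cmod_sub_le w z). pose proof (Cmod_sub_le z w).
rewrite (Cmod_swap z w) in *. lra.
Qed.

Lemma ccont_ret r z : 0 < r -> ccont (ret r) z.
Proof.
intros Hr. apply (ccont_mult (fun z => RtoC (r / Rmax r (Cmod z))) (fun z => z)).
2: exact (cdiff_ccont _ _ _ (cdiff_id z)).
(* The scaling factor r / max(r, |z|) is Lipschitz with constant 1/r. *)
intros eps He. exists (r * eps). split; [nra|]. intros w Hw.
rewrite <- RtoC_minus, Cmod_R.
pose proof (Rmax_l r (Cmod z)) as M1. pose proof (Rmax_l r (Cmod w)) as M2.
assert (M3 : Rabs (Rmax r (Cmod z) - Rmax r (Cmod w)) <= Cmod (w - z)).
{ eapply Rle_trans; [|apply Cmod_lip]. unfold Rmax, Rabs.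
  repeat (destruct Rle_dec || destruct Rcase_abs); lra. }
set (u := Rmax r (Cmod z)) in *. set (v := Rmax r (Cmod w)) in *.
replace (r / v - r / u) with ((u - v) * (r / (u * v))) by (field; lra).
rewrite Rabs_mult, (Rabs_pos_eq (r / (u * v))) by (apply Rdiv_le_0_compat; nra).
assert (B : r / (u * v) <= / r).
{ apply Rmult_le_reg_r with (u * v * r); [repeat apply Rmult_lt_0_compat; lra|].
  replace (r / (u * v) * (u * v * r)) with (r * r) by (field; lra).
  replace (/ r * (u * v * r)) with (u * v) by (field; lra). nra. }
apply Rle_lt_trans with (Cmod (w - z) * / r).
- apply Rmult_le_compat; try assumption; [apply Rabs_pos|apply Rdiv_le_0_compat; nra].
- apply Rmult_lt_reg_r with r; [exact Hr|]. rewrite Rmult_assoc, Rinv_l by lra. lra.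
Qed.

Lemma ccont_cont2 (p : C -> R) : (forall z, ccont (fun z => RtoC (p z)) z) ->
  cont2 (fun x y => p (x, y)).
Proof.
intros H x y eps. destruct (H (x, y) eps (cond_pos eps)) as [d [Hd H']].
assert (Hd2 : 0 < d / 2) by lra. exists (mkposreal _ Hd2). simpl. intros u v Hu Hv.
specialize (H' (u, v)). rewrite <- RtoC_minus, Cmod_R in H'. apply H'.
eapply Rle_lt_trans; [apply Cmod_le_abs|]. simpl.
change (Rabs (u - x) + Rabs (v - y) < d). lra.
Qed.

Lemma ccont_RtoC_Cmod f z : ccont f z -> ccont (fun z => RtoC (Cmod (f z))) z.
Proof.
intros H eps He. destruct (H eps He) as [d [Hd H']]. exists d. split; [exact Hd|].
intros w Hw. rewrite <- RtoC_minus, Cmod_R.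
eapply Rle_lt_trans; [apply Cmod_lip|apply H', Hw].
Qed.

(* The norm of the derivative from the Euclidean to the hyperbolic metric. *)
Definition ehnorm (f fp : C -> C) (z : C) : R := Cmod (fp z) * (2 / (1 - Cmod (f z) ^ 2)).

Lemma ccont_ehnorm f fp z : Cmod (f z) < 1 -> ccont f z -> ccont fp z ->
  ccont (fun z => RtoC (ehnorm f fp z)) z.
Proof.
intros Hb Hf Hfp eps He.
assert (Hc : ccont (fun z => RtoC (Cmod (fp z)) * (RtoC 2 * / (1 - RtoC (Cmod (f z)) * RtoC (Cmod (f z)))))%C z).
{ apply (ccont_mult (fun z => RtoC (Cmod (fp z))) (fun z => RtoC 2 * / (1 - RtoC (Cmod (f z)) * RtoC (Cmod (f z))))%C).
  { apply ccont_RtoC_Cmod, Hfp. }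
  apply (ccont_mult (fun _ => RtoC 2) (fun z => / (1 - RtoC (Cmod (f z)) * RtoC (Cmod (f z))))%C);
    [apply ccont_const|].
  apply (ccont_comp (fun z => / z)%C (fun z => 1 - RtoC (Cmod (f z)) * RtoC (Cmod (f z)))%C).
  - apply ccont_Cinv. rewrite <- RtoC_mult, <- RtoC_minus. intros E. apply RtoC_inj in E.
    pose proof (Cmod_ge_0 (f z)). nra.
  - apply (ccont_minus (fun _ => RtoC 1) (fun z => RtoC (Cmod (f z)) * RtoC (Cmod (f z)))%C);
      [apply ccont_const|].
    apply (ccont_mult (fun z => RtoC (Cmod (f z))) (fun z => RtoC (Cmod (f z)))); apply ccont_RtoC_Cmod, Hf. }
destruct (Hc eps He) as [d1 [Hd1 H1]].
(* Near [z] the values of f stay in the disc, so the denominator is nonzero and the real and complex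
   inverses agree. *)
destruct (ccont_RtoC_Cmod f z Hf (1 - Cmod (f z)) ltac:(lra)) as [d2 [Hd2 H2]].
exists (Rmin d1 d2). split; [apply Rmin_pos; assumption|]. intros w Hw.
assert (W1 : Cmod (w - z) < d1) by (eapply Rlt_le_trans; [exact Hw|apply Rmin_l]).
assert (W2 : Cmod (w - z) < d2) by (eapply Rlt_le_trans; [exact Hw|apply Rmin_r]).
specialize (H1 w W1). specialize (H2 w W2). rewrite <- RtoC_minus, Cmod_R in H2. apply Rabs_def2 in H2.
assert (E : forall u, Cmod (f u) < 1 -> RtoC (ehnorm f fp u) =
  (RtoC (Cmod (fp u)) * (RtoC 2 * / (1 - RtoC (Cmod (f u)) * RtoC (Cmod (f u)))))%C).
{ intros u Hu. unfold ehnorm. rewrite <- RtoC_mult, <- RtoC_minus, <- RtoC_inv, <- RtoC_mult, <- RtoC_mult.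
  - unfold Rdiv. repeat f_equal. ring.
  - pose proof (Cmod_ge_0 (f u)). nra. }
rewrite !E by lra. exact H1.
Qed.

Lemma cont2_ehnorm_ret f fp r : holo f fp -> (forall z, Cmod z < 1 -> Cmod (f z) < 1) -> 0 < r < 1 ->
  cont2 (fun x y => ehnorm f fp (ret r (x, y))).
Proof.
intros Hf Hb Hr. apply (ccont_cont2 (fun z => ehnorm f fp (ret r z))). intros z.
assert (Hz : Cmod (ret r z) < 1) by (pose proof (Cmod_ret r z); lra).
apply (ccont_comp (fun z => RtoC (ehnorm f fp z)) (ret r)); [|apply ccont_ret; lra].
apply ccont_ehnorm.
- apply Hb, Hz.
- exact (cdiff_ccont _ _ _ (Hf _ Hz)).
- apply (holo_deriv_ccont f); assumption.
Qed.

Lemma ehnorm_ge_0 f fp z : Cmod (f z) < 1 -> 0 <= ehnorm f fp z.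
Proof.
intros H. unfold ehnorm. pose proof (Cmod_ge_0 (f z)). apply Rmult_le_pos; [apply Cmod_ge_0|].
apply Rdiv_le_0_compat; nra.
Qed.

(** * Disc automorphisms *)

Lemma Cmod_pow2 (z : C) : Cmod z ^ 2 = fst z ^ 2 + snd z ^ 2.
Proof. unfold Cmod. apply pow2_sqrt. nra. Qed.

(** The one algebraic fact behind this part: it gives a nonzero denominator, values inside the disc,
    and the comparison of derivatives. *)
Lemma mobius_identity (a u : C) :
  Cmod (1 - Cconj a * u) ^ 2 - Cmod (u - a) ^ 2 = (1 - Cmod a ^ 2) * (1 - Cmod u ^ 2).
Proof. rewrite !Cmod_pow2. destruct a as [a1 a2], u as [u1 u2]. simpl. ring. Qed.

Lemma mobius_denom (a u : C) : Cmod a < 1 -> Cmod u < 1 -> (1 - Cconj a * u)%C <> 0%C.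
Proof.
intros Ha Hu E. pose proof (mobius_identity a u) as M. rewrite E, Cmod_0 in M.
pose proof (Cmod_ge_0 a). pose proof (Cmod_ge_0 u). pose proof (Cmod_ge_0 (u - a)).
assert (0 < (1 - Cmod a ^ 2) * (1 - Cmod u ^ 2)) by (apply Rmult_lt_0_compat; nra). nra.
Qed.

Definition mob (f : C -> C) (a z : C) : C := ((f z - a) * / (1 - Cconj a * f z))%C.
Definition mob' (f fp : C -> C) (a z : C) : C :=
  (fp z * RtoC (1 - Cmod a ^ 2) * / ((1 - Cconj a * f z) * (1 - Cconj a * f z)))%C.

Lemma holo_mob f fp a : holo f fp -> (forall z, Cmod z < 1 -> Cmod (f z) < 1) -> Cmod a < 1 ->
  holo (mob f a) (mob' f fp a).
Proof.
intros Hf Hb Ha z Hz. specialize (Hb z Hz). specialize (Hf z Hz).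
pose proof (mobius_denom a (f z) Ha Hb) as Hd.
assert (D1 : cdiff (fun z => f z + - a)%C z (fp z + 0)%C).
{ apply (cdiff_plus f (fun _ => - a)%C); [exact Hf|apply cdiff_const]. }
assert (D2 : cdiff (fun z => 1 + - Cconj a * f z)%C z (0 + (0 * f z + - Cconj a * fp z))%C).
{ apply (cdiff_plus (fun _ => RtoC 1) (fun z => - Cconj a * f z)%C); [apply cdiff_const|].
  apply (cdiff_mult (fun _ => - Cconj a)%C f); [apply cdiff_const|exact Hf]. }
assert (E1 : (1 + - Cconj a * f z = 1 - Cconj a * f z)%C) by ring.
assert (Eg : forall w, mob f a w = ((f w + - a) * / (1 + - Cconj a * f w))%C).
{ intros w. unfold mob. f_equal. f_equal. ring. }
assert (D3 := cdiff_comp (fun z => / z)%C (fun z => 1 + - Cconj a * f z)%C z _ _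
  (cdiff_Cinv _ (eq_ind_r (fun q : C => q <> 0%C) Hd E1)) D2).
assert (D4 := cdiff_mult _ _ _ _ _ D1 D3). simpl in D4.
assert (EL : mob' f fp a z = ((fp z + 0) * / (1 + - Cconj a * f z) +
  (f z + - a) * (- / ((1 + - Cconj a * f z) * (1 + - Cconj a * f z)) *
     (0 + (0 * f z + - Cconj a * fp z))))%C).
{ rewrite E1. unfold mob'.
  assert (Ea : RtoC (1 - Cmod a ^ 2) = (1 - a * Cconj a)%C).
  { rewrite Cmod_pow2. destruct a as [a1 a2]. unfold RtoC, Cminus, Cplus, Copp, Cmult, Cconj. simpl.
    f_equal; ring. }
  rewrite Ea. field. exact Hd. }
rewrite EL. intros eps He. destruct (D4 eps He) as [d [Hd' H]]. exists d. split; [exact Hd'|].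
intros w Hw. rewrite !Eg. apply H, Hw.
Qed.

Lemma mob_bounded f a : (forall z, Cmod z < 1 -> Cmod (f z) < 1) -> Cmod a < 1 ->
  forall z, Cmod z < 1 -> Cmod (mob f a z) < 1.
Proof.
intros Hb Ha z Hz. specialize (Hb z Hz). unfold mob.
pose proof (mobius_denom a (f z) Ha Hb) as Hd. apply Cmod_gt_0 in Hd as Hd'.
rewrite Cmod_mult, Cmod_inv by exact Hd.
pose proof (mobius_identity a (f z)) as M.
pose proof (Cmod_ge_0 a). pose proof (Cmod_ge_0 (f z)). pose proof (Cmod_ge_0 (f z - a)).
assert (0 < (1 - Cmod a ^ 2) * (1 - Cmod (f z) ^ 2)) by (apply Rmult_lt_0_compat; nra).
apply Rmult_lt_reg_r with (Cmod (1 - Cconj a * f z)); [exact Hd'|].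
rewrite Rmult_assoc, Rinv_l by lra. nra.
Qed.

Lemma Cmod_mob' f fp a z : Cmod a < 1 -> Cmod (f z) < 1 ->
  Cmod (mob' f fp a z) = Cmod (fp z) * ((1 - Cmod a ^ 2) / Cmod (1 - Cconj a * f z) ^ 2).
Proof.
intros Ha Hb. pose proof (mobius_denom a (f z) Ha Hb) as Hd. apply Cmod_gt_0 in Hd as Hd'.
unfold mob'. pose proof (Cmod_ge_0 a).
rewrite !Cmod_mult, Cmod_inv, Cmod_mult, Cmod_R, Rabs_pos_eq by (nra || (apply Cmult_neq_0; exact Hd)).
field. lra.
Qed.

(** Dropping |u - a|^2 from the identity gives (1 - |a|^2)(1 - |u|^2) <= |1 - conj(a) u|^2 with u =
    f(z); the dropped term vanishes when a = f(z), which is the equality case of the next lemma. *)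
Lemma mob'_le f fp a z : Cmod a < 1 -> Cmod (f z) < 1 ->
  Cmod (mob' f fp a z) <= ehnorm f fp z / 2.
Proof.
intros Ha Hb. rewrite Cmod_mob' by assumption.
pose proof (mobius_denom a (f z) Ha Hb) as Hd. apply Cmod_gt_0 in Hd.
pose proof (mobius_identity a (f z)) as M.
pose proof (Cmod_ge_0 a). pose proof (Cmod_ge_0 (f z)). pose proof (pow2_ge_0 (Cmod (f z - a))).
unfold ehnorm.
replace (Cmod (fp z) * (2 / (1 - Cmod (f z) ^ 2)) / 2) with (Cmod (fp z) * (1 / (1 - Cmod (f z) ^ 2)))
  by (field; nra).
apply Rmult_le_compat_l; [apply Cmod_ge_0|].
set (D := Cmod (1 - Cconj a * f z)) in *. set (u := 1 - Cmod (f z) ^ 2) in *.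
assert (0 < u) by (unfold u; nra). assert (0 < D ^ 2) by (apply pow_lt, Hd).
apply Rmult_le_reg_r with (D ^ 2 * u); [apply Rmult_lt_0_compat; assumption|].
replace ((1 - Cmod a ^ 2) / D ^ 2 * (D ^ 2 * u)) with ((1 - Cmod a ^ 2) * u) by (field; lra).
replace (1 / u * (D ^ 2 * u)) with (D ^ 2) by (field; lra). lra.
Qed.

Lemma mob'_center f fp z : Cmod (f z) < 1 -> Cmod (mob' f fp (f z) z) = ehnorm f fp z / 2.
Proof.
intros Hb. rewrite Cmod_mob' by assumption. unfold ehnorm.
pose proof (mobius_identity (f z) (f z)) as M.
replace (f z - f z)%C with (RtoC 0) in M by ring. rewrite Cmod_0 in M.
pose proof (Cmod_ge_0 (f z)).
replace (Cmod (1 - Cconj (f z) * f z) ^ 2) with ((1 - Cmod (f z) ^ 2) * (1 - Cmod (f z) ^ 2)) by lra.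
field. nra.
Qed.

Lemma RInt_recenter (h : R -> R) k x0 t : (forall x, continuous h x) ->
  ex_RInt (fun x => k * h (x0 + x)) (- t) t /\
  RInt (fun x => k * h (x0 + x)) (- t) t = k * RInt h (x0 - t) (x0 + t).
Proof.
intros Hc.
assert (K : is_RInt (fun x => k * h (x0 + x)) (- t) t (k * RInt h (x0 - t) (x0 + t))).
{ apply (is_RInt_scal (V := R_NormedModule)).
  apply (is_RInt_ext (fun x => scal 1 (h (1 * x + x0)))).
  - intros x _. unfold scal. simpl. unfold mult. simpl. rewrite !Rmult_1_l. f_equal. ring.
  - apply (is_RInt_comp_lin (V := R_NormedModule) h).
    replace (1 * - t + x0) with (x0 - t) by ring. replace (1 * t + x0) with (x0 + t) by ring.
    apply (RInt_correct (V := R_CompleteNormedModule)), ex_RInt_cont, Hc. }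
split; [eexists; exact K|apply is_RInt_unique, K].
Qed.

(* Post-composing [f] with the disc automorphism sending [f z0] to [0] does not change the
   hyperbolic derivative, and makes the Euclidean one, to which Cauchy's formula applies,
   at most half of it, with equality at [z0]. *)
Lemma side_sum_lower f fp x0 y0 t r : holo f fp -> (forall z, Cmod z < 1 -> Cmod (f z) < 1) ->
  0 < t -> Cmod (x0, y0) + 3 / 2 * t <= r -> r < 1 ->
  2 * PI * t * ehnorm f fp (x0, y0) <= side_sum (fun x y => ehnorm f fp (ret r (x, y))) x0 y0 t.
Proof.
intros Hf Hb Ht Hr Hr1. set (z0 := (x0, y0) : C).
assert (Hr0 : 0 < r) by (pose proof (Cmod_ge_0 (x0, y0)); lra).
assert (Hz0 : Cmod z0 < 1) by (unfold z0; lra).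
set (g := mob f (f z0)). set (gp := mob' f fp (f z0)).
assert (Hg : holo g gp) by (apply holo_mob; try assumption; apply Hb, Hz0).
assert (Hgb : forall z, Cmod z < 1 -> Cmod (g z) < 1) by (apply mob_bounded; [exact Hb|apply Hb, Hz0]).
set (P := fun x y => ehnorm f fp (ret r (x, y))).
assert (HP : cont2 P) by (apply cont2_ehnorm_ret; try assumption; lra).
assert (HP' := cont2_transpose P HP).
assert (F := cauchy_formula_deriv g gp z0 t Hg Hgb Ht ltac:(unfold z0; lra)).
assert (Hin : forall x y, bpt (- t) t (- t) t x y -> Cmod (z0 + (x, y))%C <= r).
{ intros x y (Hx & Hy & _). eapply Rle_trans; [apply Cmod_triangle|].
  pose proof (square_point_le t x y Hx Hy). unfold z0. lra. }
(* One factor 1/2 is from the comparison with [ehnorm], and 1/t from |z| >= t on the contour. *)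
assert (Hle : forall x y, bpt (- t) t (- t) t x y ->
  Cmod (gp (z0 + (x, y)) * / (x, y))%C <= / (2 * t) * P (x0 + x) (y0 + y)).
{ intros x y Hxy. pose proof (sqbd_point_pos t x y Ht Hxy) as Hp. pose proof (Hin x y Hxy) as Hi.
  rewrite Cmod_mult, Cmod_inv by (apply Cmod_pos_neq0; lra).
  unfold P. change ((x0 + x, y0 + y) : C) with (z0 + (x, y))%C. rewrite ret_id by assumption.
  assert (M : Cmod (gp (z0 + (x, y))%C) <= ehnorm f fp (z0 + (x, y))%C / 2).
  { apply mob'_le; apply Hb; [exact Hz0|lra]. }
  replace (/ (2 * t) * ehnorm f fp (z0 + (x, y))%C) with (ehnorm f fp (z0 + (x, y))%C / 2 * / t) by (field; lra).
  apply Rmult_le_compat; [apply Cmod_ge_0| |exact M|apply Rinv_le_contravar; lra].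
  left. apply Rinv_0_lt_compat. lra. }
assert (Hcont : bcont (fun z => gp (z0 + z) * / z)%C (- t) t (- t) t).
{ intros x y Hxy. pose proof (sqbd_point_pos t x y Ht Hxy) as Hp. pose proof (Hin x y Hxy) as Hi.
  apply (ccont_mult (fun z => gp (z0 + z)%C) (fun z => / z)%C).
  - apply ccont_shift, (holo_deriv_ccont g); try assumption. lra.
  - apply ccont_Cinv, Cmod_pos_neq0. lra. }
apply bcont_sides in Hcont as (C1 & C2 & C3 & C4); try lra.
assert (HB : forall x y, - t <= x <= t -> - t <= y <= t -> x = - t \/ x = t \/ y = - t \/ y = t ->
  bpt (- t) t (- t) t x y) by (unfold bpt; tauto).
assert (S1 : forall e, e = - t \/ e = t ->
  (forall x, - t <= x <= t -> ccont (fun z => gp (z0 + z) * / z)%C (x, e)) ->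
  Cmod (hint (fun z => gp (z0 + z) * / z)%C e (- t) t) <= / (2 * t) * RInt (fun x => P x (y0 + e)) (x0 - t) (x0 + t)).
{ intros e He Hce.
  destruct (RInt_recenter (fun x => P x (y0 + e)) (/ (2 * t)) x0 t) as [I1 I2].
  { intros x. apply (cont2_section (fun y x => P x y)), HP'. }
  rewrite <- I2. apply hint_le; [lra|exact Hce|exact I1|].
  intros x Hx. apply Hle, HB; [exact Hx|lra|tauto]. }
assert (S2 : forall e, e = - t \/ e = t ->
  (forall y, - t <= y <= t -> ccont (fun z => gp (z0 + z) * / z)%C (e, y)) ->
  Cmod (vint (fun z => gp (z0 + z) * / z)%C e (- t) t) <= / (2 * t) * RInt (P (x0 + e)) (y0 - t) (y0 + t)).
{ intros e He Hce.
  destruct (RInt_recenter (P (x0 + e)) (/ (2 * t)) y0 t) as [I1 I2].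
  { intros x. apply cont2_section, HP. }
  rewrite <- I2. apply vint_le; [lra|exact Hce|exact I1|].
  intros y Hy. apply Hle, HB; [lra|exact Hy|tauto]. }
assert (B := Cmod_bd_le (fun z => gp (z0 + z) * / z)%C (- t) t (- t) t).
unfold sqbd in F. rewrite F, Cmod_mult, Cmod_twopii in B.
unfold gp in B at 1. rewrite mob'_center in B by (apply Hb, Hz0).
pose proof (S1 (- t) ltac:(tauto) C1) as T1. pose proof (S1 t ltac:(tauto) C2) as T2.
pose proof (S2 (- t) ltac:(tauto) C3) as T3. pose proof (S2 t ltac:(tauto) C4) as T4.
unfold side_sum.
replace (y0 - t) with (y0 + - t) in * by ring. replace (x0 - t) with (x0 + - t) in * by ring.
apply Rmult_le_reg_l with (/ (2 * t)); [apply Rinv_0_lt_compat; lra|].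
replace (/ (2 * t) * (2 * PI * t * ehnorm f fp z0)) with (ehnorm f fp z0 / 2 * (2 * PI)) by (field; lra).
unfold P in *. lra.
Qed.

Definition dens (f fp : C -> C) (x y : R) : R := ehnorm f fp (x, y) ^ 2.

(** Points of the square of half-size s differ from z0 in modulus by at most (3/2) s, which places
    the square in the annulus. *)
Lemma ehnorm_sq_le_annulus f fp (z0 : C) s r1 r2 : holo f fp -> (forall z, Cmod z < 1 -> Cmod (f z) < 1) ->
  0 < s -> 0 <= r1 -> r1 <= Cmod z0 - 3 / 2 * s -> Cmod z0 + 3 / 2 * s <= r2 -> r2 < 1 ->
  s ^ 2 * ehnorm f fp z0 ^ 2 <= 2 * (disc_int (dens f fp) r2 - disc_int (dens f fp) r1).
Proof.
intros Hf Hb Hs Hr1 Hr1' Hr2 Hr21. destruct z0 as [x0 y0].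
assert (Hr0 : 0 < r2) by lra.
set (P := fun x y => ehnorm f fp (ret r2 (x, y))).
assert (HP : cont2 P) by (apply cont2_ehnorm_ret; try assumption; lra).
assert (HP0 : forall x y, 0 <= P x y).
{ intros x y. apply ehnorm_ge_0, Hb. pose proof (Cmod_ret r2 (x, y) Hr0). lra. }
set (Q := fun x y => P x y ^ 2).
assert (HQ : cont2 Q).
{ apply (cont2_mult P (fun x y => P x y * 1)); [exact HP|].
  apply (cont2_mult P); [exact HP|apply cont2_cst]. }
(* The retraction onto radius [r2] is the identity on both discs, so a single extension serves
   both. *)
assert (EQ : forall r, 0 <= r <= r2 -> disc_int (dens f fp) r = disc_int Q r).
{ intros r Hr. apply disc_int_ext; [lra|]. intros x y Hxy. unfold dens, Q, P. rewrite ret_id; [reflexivity|exact Hr0|].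
  assert (E : Cmod (x, y) ^ 2 <= r2 ^ 2) by (rewrite Cmod_pow2; simpl fst; simpl snd; nra).
  pose proof (Cmod_ge_0 (x, y)). nra. }
rewrite !EQ by lra.
assert (E0 : ehnorm f fp (x0, y0) = P x0 y0) by (unfold P; rewrite ret_id by lra; reflexivity).
rewrite E0.
eapply Rle_trans; [apply (submean_square_sq P x0 y0 s HP HP0 Hs)|].
- intros t Ht. rewrite <- E0. apply side_sum_lower; try assumption; lra.
- apply Rmult_le_compat_l; [lra|]. apply rint_annulus; try lra; [exact HQ|intros; apply pow2_ge_0|].
  intros x y Hx Hy.
  pose proof (square_point_le s (x - x0) (y - y0) ltac:(lra) ltac:(lra)) as Hq.
  assert (T : Rabs (Cmod (x, y) - Cmod (x0, y0)) <= Cmod (x - x0, y - y0)) by (apply (Cmod_lip (x0, y0) (x, y))).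
  apply Rabs_le_between in T. pose proof (Cmod_pow2 (x, y)) as E. simpl fst in E. simpl snd in E.
  rewrite <- E. pose proof (Cmod_ge_0 (x, y)). split; nra.
Qed.

(** * The hyperbolic derivative along a ray *)

Lemma area_density_eq f fp x y : area_density f fp x y = dens f fp x y.
Proof.
unfold area_density, dens, ehnorm, lamH.
change (Cmod (fp (x, y)) ^ 2 * (2 / (1 - Cmod (f (x, y)) ^ 2)) ^ 2 =
  (Cmod (fp (x, y)) * (2 / (1 - Cmod (f (x, y)) ^ 2))) ^ 2). ring.
Qed.

Lemma Defs_is_RInt (g : R -> R) a b : ex_RInt g a b -> Defs.is_RInt g a b (RInt g a b).
Proof. intros H. exists (ex_RInt_Reals_0 _ _ _ H). symmetry. apply RInt_Reals. Qed.

Lemma dens_ret f fp r : holo f fp -> (forall z, Cmod z < 1 -> Cmod (f z) < 1) -> 0 < r < 1 ->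
  exists Q, cont2 Q /\ (forall x y, 0 <= Q x y) /\
    forall x y, x ^ 2 + y ^ 2 <= r ^ 2 -> Q x y = dens f fp x y.
Proof.
intros Hf Hb Hr. exists (fun x y => ehnorm f fp (ret r (x, y)) ^ 2). repeat split.
- apply (cont2_mult _ (fun x y => ehnorm f fp (ret r (x, y)) * 1)); [apply cont2_ehnorm_ret; assumption|].
  apply (cont2_mult _ (fun _ _ => 1)); [apply cont2_ehnorm_ret; assumption|apply cont2_cst].
- intros x y. apply pow2_ge_0.
- intros x y H. unfold dens. rewrite ret_id; [reflexivity|lra|].
  assert (E : Cmod (x, y) ^ 2 <= r ^ 2) by (rewrite Cmod_pow2; exact H).
  pose proof (Cmod_ge_0 (x, y)). nra.
Qed.

(** [hyp_area_finite] bounds only those iterated integrals that exist in the sense of the standard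
    library, so the work is to prove integrability of each slice and of the slice function. *)
Lemma disc_int_dens_bounded f fp : holo f fp -> (forall z, Cmod z < 1 -> Cmod (f z) < 1) ->
  hyp_area_finite f fp -> exists M, forall r, 0 < r < 1 -> disc_int (dens f fp) r <= M.
Proof.
intros Hf Hb [M HM]. exists M. intros r Hr.
destruct (dens_ret f fp r Hf Hb Hr) as (Q & HQ & _ & EQ).
assert (Hchord : forall x y, - r <= x <= r -> - sqrt (r ^ 2 - x ^ 2) <= y <= sqrt (r ^ 2 - x ^ 2) ->
  x ^ 2 + y ^ 2 <= r ^ 2).
{ intros x y Hx Hy. assert (0 <= r ^ 2 - x ^ 2) by nra. pose proof (sqrt_sqrt _ H). nra. }
apply (HM r Hr (slice (dens f fp) r)).
- intros x Hx. unfold slice. pose proof (sqrt_pos (r ^ 2 - x ^ 2)).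
  replace (RInt (dens f fp x) (- sqrt (r ^ 2 - x ^ 2)) (sqrt (r ^ 2 - x ^ 2))) with
    (RInt (area_density f fp x) (- sqrt (r ^ 2 - x ^ 2)) (sqrt (r ^ 2 - x ^ 2)))
    by (apply RInt_ext; intros; apply area_density_eq).
  apply Defs_is_RInt. apply (ex_RInt_ext (Q x)); [|apply cont2_ex_RInt, HQ].
  intros y. rewrite Rmin_left, Rmax_right by lra. intros Hy. rewrite area_density_eq.
  apply EQ, Hchord; lra.
- apply Defs_is_RInt. apply (ex_RInt_ext (slice Q r)).
  + intros x. rewrite Rmin_left, Rmax_right by lra. intros Hx. apply RInt_ext.
    pose proof (sqrt_pos (r ^ 2 - x ^ 2)).
    intros y. rewrite Rmin_left, Rmax_right by lra. intros Hy. apply EQ, Hchord; lra.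
  + apply ex_RInt_cont. intros x. apply continuous_slice, HQ.
Qed.

Lemma disc_int_dens_mono f fp r1 r2 : holo f fp -> (forall z, Cmod z < 1 -> Cmod (f z) < 1) ->
  0 <= r1 <= r2 -> 0 < r2 < 1 -> disc_int (dens f fp) r1 <= disc_int (dens f fp) r2.
Proof.
intros Hf Hb Hr Hr2. destruct (dens_ret f fp r2 Hf Hb Hr2) as (Q & HQ & Q0 & EQ).
rewrite <- (disc_int_ext Q (dens f fp) r1), <- (disc_int_ext Q (dens f fp) r2); try lra; try exact EQ.
(* Monotonicity is the annulus inequality for the one-point rectangle at (r2, 0), whose integral is
   0. *)
- pose proof (rint_annulus Q r1 r2 r2 r2 0 0 HQ Q0 Hr) as K.
  unfold rint in K. rewrite (RInt_point (V := R_CompleteNormedModule) r2) in K.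
  change (@zero R_CompleteNormedModule) with 0 in K.
  assert (0 <= disc_int Q r2 - disc_int Q r1); [|lra].
  apply K; try lra. intros x y Hx Hy. replace x with r2 by lra. replace y with 0 by lra. nra.
- intros x y H. apply EQ. nra.
Qed.

(** * Euclidean radii in terms of hyperbolic distance *)

Lemma tanh_half t : tanh (t / 2) = 1 - 2 / (exp t + 1).
Proof.
pose proof (exp_pos t). pose proof (exp_pos (t / 2)) as H1.
assert (E : exp t = exp (t / 2) * exp (t / 2)) by (rewrite <- exp_plus; f_equal; field).
unfold tanh, sinh, cosh. rewrite exp_Ropp, E. field. nra.
Qed.

Lemma tanh_half_bound t : - 1 < tanh (t / 2) < 1.
Proof.
rewrite tanh_half. pose proof (exp_pos t).
assert (0 < 2 / (exp t + 1)) by (apply Rdiv_lt_0_compat; lra).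
assert (2 / (exp t + 1) < 2); [|lra].
apply Rmult_lt_reg_r with (exp t + 1); [lra|]. unfold Rdiv. rewrite Rmult_assoc, Rinv_l; lra.
Qed.

Lemma tanh_half_mono s t : s <= t -> tanh (s / 2) <= tanh (t / 2).
Proof.
intros H. rewrite !tanh_half. pose proof (exp_pos s).
assert (exp s <= exp t) by (destruct H as [H|H]; [left; apply exp_increasing, H|right; rewrite H; reflexivity]).
assert (/ (exp t + 1) <= / (exp s + 1)) by (apply Rinv_le_contravar; lra).
unfold Rdiv. lra.
Qed.

Lemma tanh_half_nonneg t : 0 <= t -> 0 <= tanh (t / 2).
Proof.
intros H. replace 0 with (tanh (0 / 2)); [apply tanh_half_mono, H|].
rewrite tanh_half, exp_0. field.
Qed.

(* The Euclidean square of half-size [kap (1 - r^2)] around a point of modulus [r = tanh (t/2)]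
   stays in the hyperbolic annulus of radii [t - 1] and [t + 1]; see [tanh_half_gap]. *)
Definition kap : R := (exp 1 - 1) / (3 * exp 1).

Lemma exp_1_gt_1 : 1 < exp 1.
Proof. pose proof (exp_increasing 0 1 Rlt_0_1) as H. rewrite exp_0 in H. exact H. Qed.

Lemma kap_pos : 0 < kap.
Proof. pose proof exp_1_gt_1. apply Rdiv_lt_0_compat; lra. Qed.

(** With E = exp t and q = exp 1, (3/2) s equals 2 E (q - 1) / (q (E + 1)^2), while the outer and
    inner gaps are 2 E (q - 1) divided by (E q + 1)(E + 1) and (E + q)(E + 1). Since E q + 1 and E +
    q are both at most q (E + 1), this value of [kap] works for every t. *)
Lemma tanh_half_gap t : let s := kap * (1 - tanh (t / 2) ^ 2) in
  tanh (t / 2) + 3 / 2 * s <= tanh ((t + 1) / 2) /\ tanh ((t - 1) / 2) <= tanh (t / 2) - 3 / 2 * s.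
Proof.
intros s. unfold s, kap. rewrite !tanh_half.
assert (E1 : exp (t + 1) = exp t * exp 1) by apply exp_plus.
assert (E2 : exp (t - 1) = exp t / exp 1) by (unfold Rminus; rewrite exp_plus, exp_Ropp; reflexivity).
rewrite E1, E2. pose proof exp_1_gt_1 as Hq. pose proof (exp_pos t) as HE.
set (q := exp 1) in *. set (E := exp t) in *.
assert (HqE : 0 < E * q) by nra.
split; apply Rminus_le_0.
- replace (1 - 2 / (E * q + 1) - (1 - 2 / (E + 1) + 3 / 2 * ((q - 1) / (3 * q) * (1 - (1 - 2 / (E + 1)) ^ 2))))
    with (2 * E * (q - 1) * (q - 1) / (q * (E * q + 1) * ((E + 1) * (E + 1)))) by (field; lra).
  apply Rdiv_le_0_compat; [repeat apply Rmult_le_pos; lra|repeat apply Rmult_lt_0_compat; lra].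
- replace (1 - 2 / (E + 1) - 3 / 2 * ((q - 1) / (3 * q) * (1 - (1 - 2 / (E + 1)) ^ 2)) - (1 - 2 / (E / q + 1)))
    with (2 * E * E * (q - 1) * (q - 1) / (q * (E + q) * ((E + 1) * (E + 1)))) by (field; lra).
  apply Rdiv_le_0_compat; [repeat apply Rmult_le_pos; lra|repeat apply Rmult_lt_0_compat; lra].
Qed.

Lemma continuous_tanh_half t : continuous (fun t => tanh (t / 2)) t.
Proof.
apply (continuous_ext (fun t => 1 - 2 / (exp t + 1))); [intros; symmetry; apply tanh_half|].
apply (ex_derive_continuous (V := R_NormedModule)). auto_derive.
pose proof (exp_pos t). lra.
Qed.

Lemma Cmod_dir theta r : Cmod (r * cos theta, r * sin theta) = Rabs r.
Proof.
unfold Cmod. simpl fst. simpl snd. rewrite <- sqrt_Rsqr_abs. f_equal. unfold Rsqr.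
pose proof (sin2_cos2 theta) as H. unfold Rsqr in H.
replace ((r * cos theta) ^ 2 + (r * sin theta) ^ 2)
  with (r * r * (sin theta * sin theta + cos theta * cos theta)) by ring.
rewrite H. ring.
Qed.

Lemma Cmod_gamma theta t : Cmod (gamma theta t) = Rabs (tanh (t / 2)).
Proof. apply Cmod_dir. Qed.

Lemma Cmod_gamma_lt theta t : Cmod (gamma theta t) < 1.
Proof. rewrite Cmod_gamma. apply Rabs_def1; apply tanh_half_bound. Qed.

Lemma LH_integrand_eq f fp theta t :
  LH_integrand f fp theta t = ehnorm f fp (gamma theta t) * ((1 - tanh (t / 2) ^ 2) / 2).
Proof.
unfold LH_integrand, hyp_norm_deriv, lamH, ehnorm.
change (Defs.Cmod (gamma theta t)) with (Cmod (gamma theta t)). rewrite Cmod_gamma, pow2_abs.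
pose proof (tanh_half_bound t).
change (Defs.Cmod) with Cmod.
replace ((1 - tanh (t / 2) ^ 2) / 2) with (/ (2 / (1 - tanh (t / 2) ^ 2))) by (field; nra).
reflexivity.
Qed.

Lemma continuous_LH f fp theta t : holo f fp -> (forall z, Cmod z < 1 -> Cmod (f z) < 1) ->
  continuous (LH_integrand f fp theta) t.
Proof.
intros Hf Hb.
apply (continuous_ext (fun t => ehnorm f fp (gamma theta t) * ((1 - tanh (t / 2) ^ 2) / 2)));
  [intros; symmetry; apply LH_integrand_eq|].
apply (continuous_mult (K := R_AbsRing) (fun t => ehnorm f fp (gamma theta t)) (fun t => (1 - tanh (t / 2) ^ 2) / 2)).
- apply continuous_eps. intros eps He. pose proof (Cmod_gamma_lt theta t) as Hz.
  destruct (ccont_ehnorm f fp (gamma theta t) (Hb _ Hz) (cdiff_ccont _ _ _ (Hf _ Hz))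
    (holo_deriv_ccont f fp _ Hf Hb Hz) eps He) as [d [Hd H]].
  destruct (continuous_eps_inv _ _ (continuous_tanh_half t) d Hd) as [d' [Hd' H']].
  exists d'. split; [exact Hd'|]. intros s Hs.
  specialize (H (gamma theta s)). rewrite <- RtoC_minus, Cmod_R in H. apply H.
  replace (gamma theta s - gamma theta t)%C with
    (((tanh (s / 2) - tanh (t / 2)) * cos theta, (tanh (s / 2) - tanh (t / 2)) * sin theta) : C)%R.
  + rewrite Cmod_dir. apply H', Hs.
  + unfold gamma, Cminus, Cplus, Copp. simpl. f_equal; ring.
- apply (continuous_comp (fun t => tanh (t / 2)) (fun u => (1 - u ^ 2) / 2)).
  + apply continuous_tanh_half.
  + apply (ex_derive_continuous (V := R_NormedModule)). auto_derive. exact I.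
Qed.

Lemma LH_nonneg f fp theta t : (forall z, Cmod z < 1 -> Cmod (f z) < 1) -> 0 <= LH_integrand f fp theta t.
Proof.
intros Hb. rewrite LH_integrand_eq. pose proof (tanh_half_bound t).
apply Rmult_le_pos; [apply ehnorm_ge_0, Hb, Cmod_gamma_lt|nra].
Qed.

(** * Unit steps along the ray and telescoping areas *)

Definition hyp_disc_area f fp (t : R) : R := disc_int (dens f fp) (tanh (t / 2)).

(** One annulus, of hyperbolic radii k - 1 and k + 2, contains those of radii t - 1 and t + 1 for
    all t in the unit step; k >= 1 keeps its inner radius nonnegative. *)
Lemma LH_sq_le f fp theta k t : holo f fp -> (forall z, Cmod z < 1 -> Cmod (f z) < 1) ->
  1 <= k -> k <= t <= k + 1 ->
  LH_integrand f fp theta t ^ 2 <=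
    / (2 * kap ^ 2) * (hyp_disc_area f fp (k + 2) - hyp_disc_area f fp (k - 1)).
Proof.
intros Hf Hb Hk Ht. pose proof kap_pos as Hkap. pose proof (tanh_half_bound t) as HT.
destruct (tanh_half_gap t) as [G1 G2]. set (s := kap * (1 - tanh (t / 2) ^ 2)) in *.
assert (Hs : 0 < s) by (apply Rmult_lt_0_compat; [exact Hkap|nra]).
(* The reciprocal density (1 - tanh^2) / 2 at the point of the ray is s / (2 [kap]). *)
assert (E : LH_integrand f fp theta t ^ 2 = / (4 * kap ^ 2) * (s ^ 2 * ehnorm f fp (gamma theta t) ^ 2)).
{ rewrite LH_integrand_eq. unfold s. field. lra. }
rewrite E.
replace (/ (2 * kap ^ 2) * (hyp_disc_area f fp (k + 2) - hyp_disc_area f fp (k - 1))) with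
  (/ (4 * kap ^ 2) * (2 * (hyp_disc_area f fp (k + 2) - hyp_disc_area f fp (k - 1)))) by (field; lra).
apply Rmult_le_compat_l.
{ left. apply Rinv_0_lt_compat. assert (0 < kap ^ 2) by (apply pow_lt, Hkap). lra. }
pose proof (tanh_half_mono (t + 1) (k + 2) ltac:(lra)). pose proof (tanh_half_mono (k - 1) (t - 1) ltac:(lra)).
assert (Eg : Cmod (gamma theta t) = tanh (t / 2)).
{ rewrite Cmod_gamma. apply Rabs_pos_eq, tanh_half_nonneg. lra. }
apply ehnorm_sq_le_annulus; try assumption; try lra.
- apply tanh_half_nonneg. lra.
- apply tanh_half_bound.
Qed.

(** Consecutive annuli have width 3 and overlap; summing three neighbouring areas into [T] makes the
    area from k - 1 to k + 2 equal to T(k + 1) - T(k), so the sum telescopes. *)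
Lemma RInt_LH_le f fp theta eta (N n : nat) : holo f fp -> (forall z, Cmod z < 1 -> Cmod (f z) < 1) ->
  0 < eta -> (1 <= N)%nat ->
  let D := / (2 * kap ^ 2) in
  let T := fun k => hyp_disc_area f fp (k + 1) + hyp_disc_area f fp k + hyp_disc_area f fp (k - 1) in
  RInt (LH_integrand f fp theta) (INR N) (INR N + INR n) <=
    INR n * eta / 2 + D / (2 * eta) * (T (INR N + INR n) - T (INR N)).
Proof.
intros Hf Hb He HN D T. induction n as [|n IH].
- rewrite !Rplus_0_r, (RInt_point (V := R_CompleteNormedModule)).
  change (@zero R_CompleteNormedModule) with 0. right. simpl. field. lra.
- assert (Hc : forall t, continuous (LH_integrand f fp theta) t) by (intros; apply continuous_LH; assumption).
  rewrite (RInt_split _ (INR N) (INR N + INR n)) by exact Hc.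
  set (k := INR N + INR n) in *.
  assert (Hk : 1 <= k).
  { apply le_INR in HN. simpl in HN. pose proof (pos_INR n). unfold k. lra. }
  rewrite S_INR. replace (INR N + (INR n + 1)) with (k + 1) by (unfold k; ring).
  assert (S1 : RInt (LH_integrand f fp theta) k (k + 1) <= eta / 2 +
     D / (2 * eta) * (hyp_disc_area f fp (k + 2) - hyp_disc_area f fp (k - 1))).
  { set (c := eta / 2 + _). replace c with (RInt (fun _ => c) k (k + 1)).
    2: { rewrite (RInt_const (V := R_CompleteNormedModule)). unfold scal. simpl. unfold mult. simpl. ring. }
    apply RInt_le; try lra; [apply ex_RInt_cont, Hc|apply ex_RInt_const|]. intros t Ht.
    pose proof (LH_sq_le f fp theta k t Hf Hb Hk ltac:(lra)) as L. fold D in L.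
    set (h := LH_integrand f fp theta t) in *. unfold c.
    set (dl := hyp_disc_area f fp (k + 2) - hyp_disc_area f fp (k - 1)) in *.
    (* AM-GM: [2 h <= eta + h^2 / eta] *)
    apply Rmult_le_reg_r with (2 * eta); [lra|].
    replace ((eta / 2 + D / (2 * eta) * dl) * (2 * eta)) with (eta ^ 2 + D * dl) by (field; lra).
    pose proof (pow2_ge_0 (h - eta)). nra. }
  unfold T in *. replace (k + 1 + 1) with (k + 2) by ring. replace (k + 1 - 1) with k by ring.
  set (x := D / (2 * eta)) in *. lra.
Qed.

Import Defs.

Theorem theorem3p2 :
  forall (f fp : Cx -> Cx),
    (forall z : Cx, Cmod z < 1 -> Cmod (f z) < 1) ->
    (forall z : Cx, Cmod z < 1 -> has_cderiv f z (fp z)) ->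
    hyp_area_finite f fp ->
    forall theta : R,
    forall eps : R, 0 < eps ->
      exists R0 : R, forall rho0 : R, R0 < rho0 ->
        exists pr : Riemann_integrable (LH_integrand f fp theta) 0 rho0,
          Rabs (RiemannInt pr) <= eps * sqrt rho0.
Proof.
intros f fp Hb Hd Hfin theta eps Heps.
assert (Hf : holo f fp) by (intros z Hz; apply has_cderiv_cdiff, Hd, Hz).
set (h := LH_integrand f fp theta).
assert (Hc : forall t, continuous h t) by (intros; apply continuous_LH; assumption).
assert (H0 : forall t, 0 <= h t) by (intros; apply LH_nonneg; assumption).
set (B := hyp_disc_area f fp).
assert (Bpos : forall t, 0 < t -> 0 < tanh (t / 2) < 1).
{ intros t Ht. split; [|apply tanh_half_bound].
  rewrite tanh_half. pose proof (exp_increasing 0 t Ht) as E. rewrite exp_0 in E.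
  assert (2 / (exp t + 1) < 1); [|lra].
  apply Rmult_lt_reg_r with (exp t + 1); [lra|]. unfold Rdiv. rewrite Rmult_assoc, Rinv_l; lra. }
assert (Bmono : forall s t, 0 <= s <= t -> 0 < t -> B s <= B t).
{ intros s t Hst Ht. unfold B, hyp_disc_area. apply disc_int_dens_mono; try assumption.
  - split; [apply tanh_half_nonneg; lra|apply tanh_half_mono; lra].
  - apply Bpos, Ht. }
destruct (disc_int_dens_bounded f fp Hf Hb Hfin) as [M HM].
destruct (completeness (fun u => exists t, 0 < t /\ u = B t)) as [S [HS1 HS2]].
{ exists M. intros u [t [Ht ->]]. apply HM, Bpos, Ht. }
{ exists (B 1), 1. split; [lra|reflexivity]. }
set (D := / (2 * kap ^ 2)).
assert (HD : 0 < D) by (apply Rinv_0_lt_compat; pose proof (pow_lt _ 2 kap_pos); lra).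
(* Chosen so that D / (2 eta) times 3 delta is (eps / 4) sqrt rho for eta = eps / (2 sqrt rho). *)
set (delta := eps ^ 2 / (12 * D)).
assert (Hdelta : 0 < delta) by (apply Rdiv_lt_0_compat; nra).
assert (Ht0 : exists t0, 0 < t0 /\ S - delta < B t0).
{ apply NNPP. intros Hn. assert (S <= S - delta); [|lra]. apply HS2. intros u [t [Ht ->]].
  apply Rnot_lt_le. intros Hlt. apply Hn. exists t. split; assumption. }
destruct Ht0 as [t0 [Ht0 HBt0]].
(* The margin 1 puts even the radius N - 1, which occurs in T(N), in the tail beyond [t0]. *)
destruct (INR_unbounded (t0 + 1)) as [N HN].
assert (HN1 : (1 <= N)%nat) by (apply INR_le; simpl; lra).
assert (Btail : forall t, t0 <= t -> S - delta < B t <= S).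
{ intros t Ht. split; [|apply HS1; exists t; split; [lra|reflexivity]].
  eapply Rlt_le_trans; [exact HBt0|apply Bmono; lra]. }
set (C0 := RInt h 0 (INR N)).
(* The first summand puts [rho] beyond N; the second makes the initial part C0 at most (eps / 2)
   sqrt rho. *)
exists (INR N + (2 * C0 / eps) ^ 2). intros rho Hrho.
pose proof (pow2_ge_0 (2 * C0 / eps)) as Hsq.
assert (Hrho0 : 0 < rho) by lra.
assert (Hsr : 0 < sqrt rho) by (apply sqrt_lt_R0, Hrho0).
pose proof (sqrt_sqrt rho (Rlt_le _ _ Hrho0)) as Hss.
assert (HC0 : 0 <= C0) by (apply RInt_ge_0; [lra|apply ex_RInt_cont, Hc|intros; apply H0]).
assert (K0 : C0 <= eps / 2 * sqrt rho).
{ assert (E : 2 * C0 / eps <= sqrt rho).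
  { rewrite <- (sqrt_pow2 (2 * C0 / eps)) by (apply Rdiv_le_0_compat; lra). apply sqrt_le_1_alt. lra. }
  replace C0 with (eps / 2 * (2 * C0 / eps)) by (field; lra). apply Rmult_le_compat_l; lra. }
destruct (nfloor_ex (rho - INR N)) as [m [Hm1 Hm2]]; [lra|].
(* Rounding up gives N + n >= rho, so the unit steps cover the segment, while N >= 1 still ensures n
   <= rho. *)
set (n := Datatypes.S m).
assert (Hn : INR n = INR m + 1) by apply S_INR.
set (eta := eps / (2 * sqrt rho)).
assert (Heta : 0 < eta) by (apply Rdiv_lt_0_compat; lra).
pose proof (RInt_LH_le f fp theta eta N n Hf Hb Heta HN1) as L. cbv zeta in L.
fold B D h in L.
match type of L with _ <= _ + _ * (?u - ?v) => set (Tl := u - v) in * end.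
(* The difference pairs three areas with three others, all between S - delta and S. *)
assert (HTl : Tl <= 3 * delta).
{ unfold Tl. pose proof (pos_INR n).
  pose proof (Btail (INR N + INR n + 1) ltac:(lra)). pose proof (Btail (INR N + INR n) ltac:(lra)).
  pose proof (Btail (INR N + INR n - 1) ltac:(lra)). pose proof (Btail (INR N + 1) ltac:(lra)).
  pose proof (Btail (INR N) ltac:(lra)). pose proof (Btail (INR N - 1) ltac:(lra)). lra. }
(* The budget is 1/2 for the initial part, 1/4 for the eta terms and 1/4 for the areas. *)
assert (Htot : RInt h 0 rho <= eps * sqrt rho).
{ assert (I1 : RInt h 0 rho <= RInt h 0 (INR N + INR n)) by (apply RInt_incl; try assumption; lra).
  rewrite (RInt_split h 0 (INR N) (INR N + INR n)) in I1 by exact Hc. fold C0 in I1.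
  assert (A1 : INR n * eta / 2 <= eps / 4 * sqrt rho).
  { replace (eps / 4 * sqrt rho) with (rho * eta / 2).
    - assert (1 <= INR N) by (apply le_INR in HN1; exact HN1).
      apply Rmult_le_compat_r; [lra|]. apply Rmult_le_compat_r; lra.
    - unfold eta. rewrite <- Hss at 1. field. lra. }
  assert (A2 : D / (2 * eta) * Tl <= eps / 4 * sqrt rho).
  { replace (eps / 4 * sqrt rho) with (D / (2 * eta) * (3 * delta)).
    - apply Rmult_le_compat_l; [|exact HTl]. apply Rlt_le, Rdiv_lt_0_compat; lra.
    - unfold eta, delta. field. lra. }
  lra. }
exists (ex_RInt_Reals_0 _ _ _ (ex_RInt_cont h 0 rho Hc)).
rewrite <- RInt_Reals. rewrite Rabs_pos_eq; [exact Htot|].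
apply RInt_ge_0; [lra|apply ex_RInt_cont, Hc|intros; apply H0].
Qed.
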